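(* Let $\mathcal{B},\widetilde{\mathcal{B}}$ be finite 2-categories. Any biequivalence $\mathcal{F}:\mathcal{B}\to\widetilde{\mathcal{B}}$ induces (by the construction $(V,\sigma)\mapsto\widehat{\mathcal{F}}(V,\sigma)$ given in the context) a monoidal equivalence $\widehat{\mathcal{F}}:Z(\mathcal{B})\to Z(\widetilde{\mathcal{B}})$ between the centers.
   Context: Throughout, $\Bbbk$ is an algebraically closed field; all (hom-)categories are abelian $\Bbbk$-linear and all functors additive $\Bbbk$-linear. 2-categories are strict; $\circ$ is horizontal composition, juxtaposition is vertical composition, $I_A$ is the identity 1-cell of $A$. A left dual of $X\in\mathcal{B}(A,B)$ is a 1-cell ${}^*X\in\mathcal{B}(B,A)$ with 2-cells $X\circ{}^*X\to I_B$, $I_A\to{}^*X\circ X$ satisfying the two triangle identities; a right dual $X^*$ is defined similarly with $X^*\circ X\to I_A$, $I_B\to X\circ X^*$. $\mathcal{B}$ is rigid if every 1-cell has left and right duals. A finite category is one equivalent to finite-dimensional modules over a finite-dimensional $\Bbbk$-algebra. A finite 2-category is a rigid 2-category with all $\mathcal{B}(A,B)$ finite and all $I_A$ simple in $\mathcal{B}(A,A)$. A pseudofunctor $(F,\alpha)$ has natural isomorphisms $\alpha_{X,Y}:F(X)\circ F(Y)\to F(X\circ Y)$ and $\phi_A:I_{F(A)}\to F(I_A)$ satisfying the usual axioms. A pseudonatural transformation $\chi:F\to G$ consists of 1-cells $\chi^0_A:F(A)\to G(A)$ and invertible 2-cells $\chi_X:G(X)\circ\chi^0_A\to\chi^0_B\circ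 F(X)$ natural in $X\in\mathcal{B}(A,B)$, with the usual axioms; modifications are as usual. The composite $\theta\circ\sigma$ has $(\theta\circ\sigma)^0_A=\theta^0_A\circ\sigma^0_A$ and $(\theta\circ\sigma)_X=(\mathrm{id}_{\theta^0_B}\circ\sigma_X)(\theta_X\circ\mathrm{id}_{\sigma^0_A})$. A biequivalence is a pseudofunctor $F$ for which there is a pseudofunctor $G$ with $G\circ F$ and $F\circ G$ pseudonaturally equivalent to the identities (a pseudonatural equivalence being one invertible up to invertible modifications). Center: objects of $Z(\mathcal{B})$ are pairs $(V,\sigma)$ with 1-cells $V_A\in\mathcal{B}(A,A)$ for each 0-cell $A$ and isomorphisms $\sigma_X:V_B\circ X\to X\circ V_A$ natural in $X\in\mathcal{B}(A,B)$, with $\sigma_{I_A}=\mathrm{id}$ and $\sigma_{X\circ Y}=(\mathrm{id}_X\circ\sigma_Y)(\sigma_X\circ\mathrm{id}_Y)$ for composable $X,Y$. Morphisms $f:(V,\sigma)\to(W,\tau)$ are families $f_A:V_A\to W_A$ with $(\mathrm{id}_X\circ f_A)\sigma_X=\tau_X(f_B\circ\mathrm{id}_X)$. The tensor product is $(V\otimes W)_A=V_A\circ W_A$, $(\sigma\otimes\tau)_X=(\sigma_X\circ\mathrm{id}_{W_A})(\mathrm{id}_{V_B}\circ\tau_X)$; the unit is $(I_A)_A$ with identity half-braiding. The construction $\widehat{\mathcal{F}}$: let $(\mathcal{F},\alpha)$ be the biequivalence, $\mathcal{G}:\widetilde{\mathcal{B}}\to\mathcal{B}$ a quasi-inverse biequivalence,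 $\chi:\mathcal{F}\circ\mathcal{G}\to\mathrm{Id}_{\widetilde{\mathcal{B}}}$ and $\tau:\mathrm{Id}_{\widetilde{\mathcal{B}}}\to\mathcal{F}\circ\mathcal{G}$ mutually inverse pseudonatural equivalences, and $\omega:\tau\circ\chi\to\mathrm{id}_{\mathcal{F}\circ\mathcal{G}}$ an invertible modification. For $(V,\sigma)\in Z(\mathcal{B})$ and a 0-cell $C$ of $\widetilde{\mathcal{B}}$ set $\widehat{\mathcal{F}}(V)_C=\chi^0_C\circ\mathcal{F}(V_{\mathcal{G}(C)})\circ\tau^0_C$, and for $Y\in\widetilde{\mathcal{B}}(C,D)$ let $\widehat{\mathcal{F}}(\sigma)_Y:\widehat{\mathcal{F}}(V)_D\circ Y\to Y\circ\widehat{\mathcal{F}}(V)_C$ be the composite of $\mathrm{id}\circ(\tau_Y)^{-1}$, then $\mathrm{id}\circ\alpha\circ\mathrm{id}$, then $\mathrm{id}_{\chi^0_D}\circ\mathcal{F}(\sigma_{\mathcal{G}(Y)})\circ\mathrm{id}_{\tau^0_C}$, then $\mathrm{id}\circ\alpha^{-1}\circ\mathrm{id}$, then $(\chi_Y)^{-1}\circ\mathrm{id}$. The monoidal structure $\widehat{\mathcal{F}}(V)\otimes\widehat{\mathcal{F}}(W)\to\widehat{\mathcal{F}}(V\otimes W)$ at $C$ is $(\mathrm{id}\circ\alpha_{V_{\mathcal{G}(C)},W_{\mathcal{G}(C)}}\circ\mathrm{id})(\mathrm{id}\circ\omega_C\circ\mathrm{id})$. *)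

(* Defs.v *)
From HB Require Import structures.
From mathcomp Require Import all_boot all_order all_algebra.
From mathcomp Require Import boolp.

Set Implicit Arguments.
Unset Strict Implicit.
Unset Printing Implicit Defensive.

Import GRing.Theory.
Local Open Scope ring_scope.

Reserved Notation "X ⟶ Y" (at level 70, no associativity).
Reserved Notation "f ∙ g" (at level 45, right associativity).
Reserved Notation "X ∘ Y" (at level 40, left associativity).
Reserved Notation "f ⊚ g" (at level 40, left associativity).
Reserved Notation "X ◁ f" (at level 40, left associativity).
Reserved Notation "f ▷ X" (at level 40, left associativity).
Reserved Notation "X ⊗ Y" (at level 40, left associativity).
Reserved Notation "f ⊠ g" (at level 40, left associativity).
Reserved Notation "f ⁻¹" (at level 1, format "f ⁻¹").
Reserved Notation "F ⟨ X ⟩" (at level 1, format "F ⟨ X ⟩").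
Reserved Notation "F ⟪ f ⟫" (at level 1, format "F ⟪ f ⟫").

Record lincat (k : fieldType) := LinCat {
  ob :> Type;
  hom : ob -> ob -> lmodType k;
  idm : forall X, hom X X;
  cmp : forall X Y Z, hom Y Z -> hom X Y -> hom X Z;
  cmpA : forall X Y Z W (f : hom Z W) (g : hom Y Z) (h : hom X Y),
    cmp (cmp f g) h = cmp f (cmp g h);
  cmp1m : forall X Y (f : hom X Y), cmp (idm Y) f = f;
  cmpm1 : forall X Y (f : hom X Y), cmp f (idm X) = f;
  cmpDl : forall X Y Z (f f' : hom Y Z) (g : hom X Y),
    cmp (f + f') g = cmp f g + cmp f' g;
  cmpZl : forall X Y Z c (f : hom Y Z) (g : hom X Y),
    cmp (c *: f) g = c *: cmp f g;
  cmpDr : forall X Y Z (f : hom Y Z) (g g' : hom X Y),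
    cmp f (g + g') = cmp f g + cmp f g';
  cmpZr : forall X Y Z c (f : hom Y Z) (g : hom X Y),
    cmp f (c *: g) = c *: cmp f g }.

Arguments idm {k l} X.
Notation "X ⟶ Y" := (hom X Y).
Notation "f ∙ g" := (cmp f g).

Section Isos.
Variables (k : fieldType) (C : lincat k).

Record iso (X Y : C) := Iso {
  fwd :> X ⟶ Y;
  bwd : Y ⟶ X;
  bwdK : bwd ∙ fwd = idm X;
  fwdK : fwd ∙ bwd = idm Y }.

Definition is_iso (X Y : C) (f : X ⟶ Y) : Prop :=
  exists g : Y ⟶ X, g ∙ f = idm X /\ f ∙ g = idm Y.

Definition is_mono (X Y : C) (f : X ⟶ Y) : Prop :=
  forall Z (g h : Z ⟶ X), f ∙ g = f ∙ h -> g = h.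

Definition is_epi (X Y : C) (f : X ⟶ Y) : Prop :=
  forall Z (g h : Y ⟶ Z), g ∙ f = h ∙ f -> g = h.

Definition is_kernel (N X Y : C) (i : N ⟶ X) (f : X ⟶ Y) : Prop :=
  f ∙ i = 0 /\
  forall Z (g : Z ⟶ X), f ∙ g = 0 -> exists! h : Z ⟶ N, i ∙ h = g.

Definition is_cokernel (X Y Q : C) (p : Y ⟶ Q) (f : X ⟶ Y) : Prop :=
  p ∙ f = 0 /\
  forall Z (g : Y ⟶ Z), g ∙ f = 0 -> exists! h : Q ⟶ Z, h ∙ p = g.

Record is_abelian : Prop := IsAbelian {
  has_zero : exists O : C, idm O = 0;
  has_biproducts : forall X Y : C, exists (S : C)
    (i : X ⟶ S) (j : Y ⟶ S) (p : S ⟶ X) (q : S ⟶ Y),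
    [/\ p ∙ i = idm X, q ∙ j = idm Y & i ∙ p + j ∙ q = idm S];
  has_kernels : forall (X Y : C) (f : X ⟶ Y),
    exists (N : C) (i : N ⟶ X), is_kernel i f;
  has_cokernels : forall (X Y : C) (f : X ⟶ Y),
    exists (Q : C) (p : Y ⟶ Q), is_cokernel p f;
  mono_normal : forall (X Y : C) (f : X ⟶ Y), is_mono f ->
    exists (Z : C) (g : Y ⟶ Z), is_kernel f g;
  epi_normal : forall (X Y : C) (f : X ⟶ Y), is_epi f ->
    exists (Z : C) (g : Z ⟶ X), is_cokernel f g }.

Definition is_simple (X : C) : Prop :=
  idm X <> 0 /\
  forall Y (i : Y ⟶ X), is_mono i -> i = 0 \/ is_iso i.

Definition eqhom (X Y : C) (e : X = Y) : X ⟶ Y :=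
  match e in _ = Z return X ⟶ Z with erefl => idm X end.

End Isos.

Notation "f ⁻¹" := (bwd f).

Section LinearFunctors.
Variable k : fieldType.

Record functor_data (C D : lincat k) := FunctorData {
  fob :> C -> D;
  fmap : forall X Y, X ⟶ Y -> fob X ⟶ fob Y }.

Record is_linfun (C D : lincat k) (F : functor_data C D) : Prop := IsLinFun {
  fmap1 : forall X, fmap F (idm X) = idm (F X);
  fmapM : forall X Y Z (f : Y ⟶ Z) (g : X ⟶ Y),
    fmap F (f ∙ g) = fmap F f ∙ fmap F g;
  fmapD : forall X Y (f g : X ⟶ Y), fmap F (f + g) = fmap F f + fmap F g;
  fmapZ : forall X Y c (f : X ⟶ Y), fmap F (c *: f) = c *: fmap F f }.

Record linfun (C D : lincat k) := LinFun {
  lf_data :> functor_data C D;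
  lf_law : is_linfun lf_data }.

Definition id_functor (C : lincat k) : functor_data C C :=
  @FunctorData C C (fun X => X) (fun X Y f => f).

Definition comp_functor (C D E : lincat k)
    (G : functor_data D E) (F : functor_data C D) : functor_data C E :=
  @FunctorData C E (fun X => G (F X)) (fun X Y f => fmap G (fmap F f)).

Definition natiso (C D : lincat k) (F G : functor_data C D) : Prop :=
  exists t : forall X, iso (F X) (G X),
    forall X Y (f : X ⟶ Y), t Y ∙ fmap F f = fmap G f ∙ t X.

Definition is_equivalence (C D : lincat k) (F : functor_data C D) : Prop :=
  is_linfun F /\
  exists G : linfun D C,
    natiso (comp_functor G F) (id_functor C) /\
    natiso (comp_functor F G) (id_functor D).

Lemma id_linfun (C : lincat k) : is_linfun (id_functor C).
Proof. by []. Qed.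

Lemma comp_linfun (C D E : lincat k) (G : functor_data D E)
  (F : functor_data C D) :
  is_linfun G -> is_linfun F -> is_linfun (comp_functor G F).
Proof.
by move=> hG hF; split=> *; rewrite /= ?(fmap1, fmapM, fmapD, fmapZ).
Qed.

End LinearFunctors.

(* Not [falgType]: its rings are nontrivial, while the zero algebra, whose
   category of modules is the zero category, has to be allowed here. *)
Record fdalg (k : fieldType) := FdAlg {
  fdalg_sort :> vectType k;
  amul : fdalg_sort -> fdalg_sort -> fdalg_sort;
  aone : fdalg_sort;
  amulA : associative amul;
  amul1l : left_id aone amul;
  amulr1 : right_id aone amul;
  amulDl : left_distributive amul +%R;
  amulDr : right_distributive amul +%R;
  amulZl : forall c a b, amul (c *: a) b = c *: amul a b;
  amulZr : forall c a b, amul a (c *: b) = c *: amul a b }.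

Section Modules.
Variables (k : fieldType) (A : fdalg k).

Record fdmod := FdMod {
  fdmod_sort :> vectType k;
  act : A -> fdmod_sort -> fdmod_sort;
  act1 : forall v, act (aone A) v = v;
  actA : forall a b v, act (amul a b) v = act a (act b v);
  actDl : forall a b v, act (a + b) v = act a v + act b v;
  actZl : forall c a v, act (c *: a) v = c *: act a v;
  actDr : forall a v w, act a (v + w) = act a v + act a w;
  actZr : forall c a v, act a (c *: v) = c *: act a v }.

Record modhom (V W : fdmod) := ModHom {
  mhom :> 'Hom(V, W);
  mhomP : forall a v, mhom (act a v) = act a (mhom v) }.

Section ModHom.
Variables V W : fdmod.
Implicit Types f g h : modhom V W.

Lemma modhom_eq f g : mhom f = mhom g -> f = g.
Proof.
case: f g => [f fP] [g gP] /= e; rewrite e in fP *.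
by congr ModHom; apply: Prop_irrelevance.
Qed.

Lemma act0r (U : fdmod) a : act a (0 : U) = 0.
Proof. by rewrite -[in LHS](scale0r (0 : U)) actZr scale0r. Qed.

Lemma actNr (U : fdmod) a (v : U) : act a (- v) = - act a v.
Proof. by rewrite -scaleN1r actZr scaleN1r. Qed.

Fact mh0P a v : (0 : 'Hom(V, W)) (act a v) = act a ((0 : 'Hom(V, W)) v).
Proof. by rewrite !zero_lfunE act0r. Qed.

Fact mhNP f a v : (- mhom f) (act a v) = act a ((- mhom f) v).
Proof. by rewrite !opp_lfunE mhomP actNr. Qed.

Fact mhDP f g a v :
  (mhom f + mhom g) (act a v) = act a ((mhom f + mhom g) v).
Proof. by rewrite !add_lfunE !mhomP actDr. Qed.

Fact mhZP c f a v : (c *: mhom f) (act a v) = act a ((c *: mhom f) v).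
Proof. by rewrite !scale_lfunE mhomP actZr. Qed.

HB.instance Definition _ := gen_eqMixin (modhom V W).
HB.instance Definition _ := gen_choiceMixin (modhom V W).

Definition mh0 := ModHom mh0P.
Definition mhN f := ModHom (mhNP f).
Definition mhD f g := ModHom (mhDP f g).
Definition mhZ c f := ModHom (mhZP c f).

Fact mhDA : associative mhD.
Proof. by move=> f g h; apply: modhom_eq; apply: addrA. Qed.
Fact mhDC : commutative mhD.
Proof. by move=> f g; apply: modhom_eq; apply: addrC. Qed.
Fact mh0D : left_id mh0 mhD.
Proof. by move=> f; apply: modhom_eq; apply: add0r. Qed.
Fact mhND : left_inverse mh0 mhN mhD.
Proof. by move=> f; apply: modhom_eq; apply: addNr. Qed.

HB.instance Definition _ :=
  GRing.isZmodule.Build (modhom V W) mhDA mhDC mh0D mhND.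

Fact mhZA c d f : mhZ c (mhZ d f) = mhZ (c * d) f.
Proof. by apply: modhom_eq; apply: scalerA. Qed.
Fact mh1Z : left_id 1 mhZ.
Proof. by move=> f; apply: modhom_eq; apply: scale1r. Qed.
Fact mhZDr : right_distributive mhZ +%R.
Proof. by move=> c f g; apply: modhom_eq; apply: scalerDr. Qed.
Fact mhZDl f : {morph mhZ^~ f : c d / c + d}.
Proof. by move=> c d; apply: modhom_eq; apply: scalerDl. Qed.

HB.instance Definition _ :=
  GRing.Zmodule_isLmodule.Build k (modhom V W) mhZA mh1Z mhZDr mhZDl.

End ModHom.

Fact mh1P (V : fdmod) a v : (\1%VF : 'Hom(V, V)) (act a v) = act a (\1%VF v).
Proof. by rewrite !id_lfunE. Qed.

Fact mhMP (U V W : fdmod) (f : modhom V W) (g : modhom U V) a v :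
  (mhom f \o mhom g)%VF (act a v) = act a ((mhom f \o mhom g)%VF v).
Proof. by rewrite !comp_lfunE !mhomP. Qed.

Definition fdmods : lincat k.
Proof.
refine (@LinCat k fdmod (fun V W => modhom V W) (fun V => ModHom (@mh1P V))
  (fun U V W f g => ModHom (mhMP f g)) _ _ _ _ _ _ _) => *; apply: modhom_eq.
- exact/esym/comp_lfunA.
- exact: comp_lfun1l.
- exact: comp_lfun1r.
- exact: comp_lfunDl.
- exact/esym/comp_lfunZl.
- exact: comp_lfunDr.
- exact/esym/comp_lfunZr.
Defined.

End Modules.

Definition is_finite_cat (k : fieldType) (C : lincat k) : Prop :=
  exists (A : fdalg k) (F : linfun C (fdmods A)), is_equivalence F.

(* [B A C] is the category of 1-cells from [A] to [C].  A strict 2-category is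
   a bicategory satisfying [is_strict] below: its 1-cells compose strictly
   associatively and unitally, and the coherence cells [asc], [lun], [run] are
   the identities, transported along these equalities of 1-cells. *)
Record bicat (k : fieldType) := Bicat {
  cell0 :> Type;
  cells :> cell0 -> cell0 -> lincat k;
  id1 : forall A, cells A A;
  comp1 : forall A B C, cells B C -> cells A B -> cells A C;
  hcomp : forall A B C (X X' : cells B C) (Y Y' : cells A B),
    X ⟶ X' -> Y ⟶ Y' -> comp1 X Y ⟶ comp1 X' Y';
  hcomp1 : forall A B C (X : cells B C) (Y : cells A B),
    hcomp (idm X) (idm Y) = idm (comp1 X Y);
  hcompM : forall A B C (X X' X'' : cells B C) (Y Y' Y'' : cells A B)
      (f' : X' ⟶ X'') (f : X ⟶ X') (g' : Y' ⟶ Y'') (g : Y ⟶ Y'),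
    hcomp (f' ∙ f) (g' ∙ g) = hcomp f' g' ∙ hcomp f g;
  hcompDl : forall A B C (X X' : cells B C) (Y Y' : cells A B)
      (f f' : X ⟶ X') (g : Y ⟶ Y'),
    hcomp (f + f') g = hcomp f g + hcomp f' g;
  hcompZl : forall A B C (X X' : cells B C) (Y Y' : cells A B)
      c (f : X ⟶ X') (g : Y ⟶ Y'),
    hcomp (c *: f) g = c *: hcomp f g;
  hcompDr : forall A B C (X X' : cells B C) (Y Y' : cells A B)
      (f : X ⟶ X') (g g' : Y ⟶ Y'),
    hcomp f (g + g') = hcomp f g + hcomp f g';
  hcompZr : forall A B C (X X' : cells B C) (Y Y' : cells A B)
      c (f : X ⟶ X') (g : Y ⟶ Y'),
    hcomp f (c *: g) = c *: hcomp f g;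
  asc : forall A B C D (X : cells C D) (Y : cells B C) (Z : cells A B),
    iso (comp1 (comp1 X Y) Z) (comp1 X (comp1 Y Z));
  lun : forall A B (X : cells A B), iso (comp1 (id1 B) X) X;
  run : forall A B (X : cells A B), iso (comp1 X (id1 A)) X;
  asc_nat : forall A B C D (X X' : cells C D) (Y Y' : cells B C)
      (Z Z' : cells A B) (f : X ⟶ X') (g : Y ⟶ Y') (h : Z ⟶ Z'),
    asc X' Y' Z' ∙ hcomp (hcomp f g) h = hcomp f (hcomp g h) ∙ asc X Y Z;
  lun_nat : forall A B (X Y : cells A B) (f : X ⟶ Y),
    lun Y ∙ hcomp (idm (id1 B)) f = f ∙ lun X;
  run_nat : forall A B (X Y : cells A B) (f : X ⟶ Y),
    run Y ∙ hcomp f (idm (id1 A)) = f ∙ run X;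
  pentagon : forall A B C D E (X : cells D E) (Y : cells C D)
      (Z : cells B C) (W : cells A B),
    asc X Y (comp1 Z W) ∙ asc (comp1 X Y) Z W =
    hcomp (idm X) (asc Y Z W) ∙ asc X (comp1 Y Z) W
      ∙ hcomp (asc X Y Z) (idm W);
  triangle : forall A B C (X : cells B C) (Y : cells A B),
    hcomp (idm X) (lun Y) ∙ asc X (id1 B) Y = hcomp (run X) (idm Y) }.

Arguments id1 {k b} A.
Arguments asc {k b A B C D} X Y Z.
Arguments lun {k b A B} X.
Arguments run {k b A B} X.

Notation "X ∘ Y" := (comp1 X Y).
Notation "f ⊚ g" := (hcomp f g).
Notation "X ◁ f" := (hcomp (idm X) f).
Notation "f ▷ X" := (hcomp f (idm X)).

Section BicatTheory.
Variables (k : fieldType) (B : bicat k).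

Lemma compKl (C : lincat k) (X Y Z : C) (i : iso Y Z) (f : X ⟶ Y) :
  i⁻¹ ∙ i ∙ f = f.
Proof. by rewrite -cmpA bwdK cmp1m. Qed.

Lemma compVKl (C : lincat k) (X Y Z : C) (i : iso Y Z) (f : X ⟶ Z) :
  i ∙ i⁻¹ ∙ f = f.
Proof. by rewrite -cmpA fwdK cmp1m. Qed.

Lemma iso_injl (C : lincat k) (X Y Z : C) (i : iso Y Z) (f g : X ⟶ Y) :
  i ∙ f = i ∙ g -> f = g.
Proof. by move=> e; rewrite -(compKl i f) e compKl. Qed.

Lemma iso_injr (C : lincat k) (X Y Z : C) (i : iso X Y) (f g : Y ⟶ Z) :
  f ∙ i = g ∙ i -> f = g.
Proof.
by move=> e; rewrite -(cmpm1 f) -(fwdK i) -cmpA e cmpA fwdK cmpm1.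
Qed.

Definition id_iso (C : lincat k) (X : C) : iso X X :=
  Iso (cmp1m (idm X)) (cmp1m (idm X)).

Definition inv_iso (C : lincat k) (X Y : C) (i : iso X Y) : iso Y X :=
  Iso (fwdK i) (bwdK i).

Lemma comp_isoP (C : lincat k) (X Y Z : C) (i : iso Y Z) (j : iso X Y) :
  (j⁻¹ ∙ i⁻¹) ∙ (i ∙ j) = idm X /\ (i ∙ j) ∙ (j⁻¹ ∙ i⁻¹) = idm Z.
Proof. by rewrite !cmpA compKl compVKl bwdK fwdK. Qed.

Definition comp_iso (C : lincat k) (X Y Z : C) (i : iso Y Z) (j : iso X Y) :
  iso X Z := Iso (comp_isoP i j).1 (comp_isoP i j).2.

Lemma hcomp_isoP (A C D : B) (X X' : B C D) (Y Y' : B A C)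
  (i : iso X X') (j : iso Y Y') :
  (i⁻¹ ⊚ j⁻¹) ∙ (i ⊚ j) = idm _ /\ (i ⊚ j) ∙ (i⁻¹ ⊚ j⁻¹) = idm _.
Proof. by rewrite -!hcompM !bwdK !fwdK !hcomp1. Qed.

Definition hcomp_iso (A C D : B) (X X' : B C D) (Y Y' : B A C)
  (i : iso X X') (j : iso Y Y') : iso (X ∘ Y) (X' ∘ Y') :=
  Iso (hcomp_isoP i j).1 (hcomp_isoP i j).2.

Lemma is_isoP (C : lincat k) (X Y : C) (i : iso X Y) : is_iso i.
Proof. by exists i⁻¹; rewrite bwdK fwdK. Qed.

Lemma is_iso_comp (C : lincat k) (X Y Z : C) (f : Y ⟶ Z) (g : X ⟶ Y) :
  is_iso f -> is_iso g -> is_iso (f ∙ g).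
Proof.
move=> [f' [f'K fK]] [g' [g'K gK]].
exact: (is_isoP (comp_iso (Iso f'K fK) (Iso g'K gK))).
Qed.

Lemma is_iso_hcomp (A C D : B) (X X' : B C D) (Y Y' : B A C)
  (f : X ⟶ X') (g : Y ⟶ Y') : is_iso f -> is_iso g -> is_iso (f ⊚ g).
Proof.
move=> [f' [f'K fK]] [g' [g'K gK]].
exact: (is_isoP (hcomp_iso (Iso f'K fK) (Iso g'K gK))).
Qed.

End BicatTheory.

Section Strict.
Variables (k : fieldType) (B : bicat k).

Record is_strict : Prop := IsStrict {
  strictA : forall (A C D E : B) (X : B D E) (Y : B C D) (Z : B A C),
    exists e : (X ∘ Y) ∘ Z = X ∘ (Y ∘ Z), asc X Y Z = eqhom e :> (_ ⟶ _);
  strictl : forall (A C : B) (X : B A C),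
    exists e : id1 C ∘ X = X, lun X = eqhom e :> (_ ⟶ _);
  strictr : forall (A C : B) (X : B A C),
    exists e : X ∘ id1 A = X, run X = eqhom e :> (_ ⟶ _) }.

Definition is_dual_pair (A C : B) (X : B A C) (Y : B C A)
    (ev : X ∘ Y ⟶ id1 C) (coev : id1 A ⟶ Y ∘ X) : Prop :=
  lun X ∙ (ev ▷ X) ∙ (asc X Y X)⁻¹ ∙ (X ◁ coev) ∙ (run X)⁻¹ = idm X /\
  run Y ∙ (Y ◁ ev) ∙ asc Y X Y ∙ (coev ▷ Y) ∙ (lun Y)⁻¹ = idm Y.

Definition has_left_dual (A C : B) (X : B A C) : Prop :=
  exists (Y : B C A) (ev : X ∘ Y ⟶ id1 C) (coev : id1 A ⟶ Y ∘ X),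
    is_dual_pair ev coev.

Definition has_right_dual (A C : B) (X : B A C) : Prop :=
  exists (Y : B C A) (ev : Y ∘ X ⟶ id1 A) (coev : id1 C ⟶ X ∘ Y),
    is_dual_pair ev coev.

Definition is_rigid : Prop :=
  forall (A C : B) (X : B A C), has_left_dual X /\ has_right_dual X.

Record is_finite_2cat : Prop := IsFinite2Cat {
  f2_strict : is_strict;
  f2_abelian : forall A C : B, is_abelian (B A C);
  f2_rigid : is_rigid;
  f2_finite : forall A C : B, is_finite_cat (B A C);
  f2_simple : forall A : B, is_simple (id1 A : B A A) }.

End Strict.

Record pseudofun (k : fieldType) (B Bt : bicat k) := PseudoFun {
  pf0 :> B -> Bt;
  pf1 : forall A C, linfun (B A C) (Bt (pf0 A) (pf0 C));
  pfa : forall (A C D : B) (X : B C D) (Y : B A C),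
    iso (pf1 C D X ∘ pf1 A C Y) (pf1 A D (X ∘ Y));
  pfu : forall A : B, iso (id1 (pf0 A)) (pf1 A A (id1 A));
  pfa_nat : forall (A C D : B) (X X' : B C D) (Y Y' : B A C)
      (f : X ⟶ X') (g : Y ⟶ Y'),
    pfa X' Y' ∙ (fmap (pf1 C D) f ⊚ fmap (pf1 A C) g) =
    fmap (pf1 A D) (f ⊚ g) ∙ pfa X Y;
  pfa_asc : forall (A C D E : B) (X : B D E) (Y : B C D) (Z : B A C),
    fmap (pf1 A E) (asc X Y Z) ∙ pfa (X ∘ Y) Z ∙ (pfa X Y ▷ pf1 A C Z) =
    pfa X (Y ∘ Z) ∙ (pf1 D E X ◁ pfa Y Z) ∙ asc _ _ _;
  pfu_lun : forall (A C : B) (X : B A C),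
    fmap (pf1 A C) (lun X) ∙ pfa (id1 C) X ∙ (pfu C ▷ pf1 A C X) = lun _;
  pfu_run : forall (A C : B) (X : B A C),
    fmap (pf1 A C) (run X) ∙ pfa X (id1 A) ∙ (pf1 A C X ◁ pfu A) = run _ }.

Notation "F ⟨ X ⟩" := (fob (lf_data (pf1 F _ _)) X).
Notation "F ⟪ f ⟫" := (fmap (lf_data (pf1 F _ _)) f).

Section PseudoFunctors.
Variables (k : fieldType) (B Bt Bh : bicat k).

Definition id_pf : pseudofun B B.
Proof.
refine (@PseudoFun k B B (fun A => A) (fun A C => LinFun (id_linfun (B A C)))
  (fun A C D X Y => id_iso (X ∘ Y)) (fun A => id_iso (id1 A)) _ _ _ _) => /=.
- by move=> *; rewrite cmp1m cmpm1.
- by move=> *; rewrite !hcomp1 !cmp1m !cmpm1.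
- by move=> *; rewrite !hcomp1 !cmpm1.
- by move=> *; rewrite !hcomp1 !cmpm1.
Defined.

Lemma fmap_isoP (F : pseudofun B Bt) (A C : B) (X Y : B A C) (i : iso X Y) :
  F⟪i⁻¹⟫ ∙ F⟪i⟫ = idm F⟨X⟩ /\ F⟪i⟫ ∙ F⟪i⁻¹⟫ = idm F⟨Y⟩.
Proof.
by rewrite -!(fmapM (lf_law (pf1 F A C))) bwdK fwdK
  !(fmap1 (lf_law (pf1 F A C))).
Qed.

Definition fmap_iso (F : pseudofun B Bt) (A C : B) (X Y : B A C)
  (i : iso X Y) : iso F⟨X⟩ F⟨Y⟩ :=
  Iso (fmap_isoP F i).1 (fmap_isoP F i).2.

End PseudoFunctors.

Section CompPseudoFunctors.
Variables (k : fieldType) (B Bt Bh : bicat k).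
Variables (G : pseudofun Bt Bh) (F : pseudofun B Bt).

Let GM A C X Y Z (f : Y ⟶ Z) (g : X ⟶ Y) :
  G⟪f ∙ g⟫ = G⟪f⟫ ∙ G⟪g⟫ := fmapM (lf_law (pf1 G A C)) f g.

Let G1 A C (X : Bt A C) : G⟪idm X⟫ = idm G⟨X⟩ :=
  fmap1 (lf_law (pf1 G A C)) X.

Let natl (A C D : Bt) (X : Bt C D) (Y Y' : Bt A C) (Z : Bh (G A) (G C))
    (f : Y ⟶ Y') (g : Z ⟶ G⟨Y⟩) :
  pfa G X Y' ∙ (G⟨X⟩ ◁ (G⟪f⟫ ∙ g)) = G⟪X ◁ f⟫ ∙ pfa G X Y ∙ (G⟨X⟩ ◁ g).
Proof.
by rewrite -[idm G⟨X⟩ in LHS]cmp1m hcompM -{1}G1 -cmpA pfa_nat cmpA.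
Qed.

Let natr (A C D : Bt) (X X' : Bt C D) (Y : Bt A C) (Z : Bh (G C) (G D))
    (f : X ⟶ X') (g : Z ⟶ G⟨X⟩) :
  pfa G X' Y ∙ ((G⟪f⟫ ∙ g) ▷ G⟨Y⟩) = G⟪f ▷ Y⟫ ∙ pfa G X Y ∙ (g ▷ G⟨Y⟩).
Proof.
by rewrite -[idm G⟨Y⟩ in LHS]cmp1m hcompM -{1}G1 -cmpA pfa_nat cmpA.
Qed.

Definition comp_pf : pseudofun B Bh.
Proof.
refine (@PseudoFun k B Bh (fun A => G (F A))
  (fun A C => LinFun (comp_linfun (lf_law (pf1 G (F A) (F C)))
                                  (lf_law (pf1 F A C))))
  (fun A C D X Y => comp_iso (fmap_iso G (pfa F X Y)) (pfa G F⟨X⟩ F⟨Y⟩))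
  (fun A => comp_iso (fmap_iso G (pfu F A)) (pfu G (F A))) _ _ _ _) => /=.
- move=> A C D X X' Y Y' f g.
  by rewrite cmpA pfa_nat -!cmpA -!GM pfa_nat.
- move=> A C D E X Y Z.
  rewrite !cmpA natr -(cmpA (pfa G _ _) _ (asc _ _ _)) natl !cmpA -pfa_asc.
  by rewrite -!cmpA -!GM !cmpA pfa_asc.
- move=> A C X.
  by rewrite !cmpA natr -(pfu_lun G) -(pfu_lun F) !GM !cmpA.
- move=> A C X.
  by rewrite !cmpA natl -(pfu_run G) -(pfu_run F) !GM !cmpA.
Defined.

End CompPseudoFunctors.

Section Coherence.
Variables (k : fieldType) (B : bicat k).

Lemma hcompMl (A C D : B) (X X' X'' : B C D) (Y : B A C)
  (f' : X' ⟶ X'') (f : X ⟶ X') : (f' ∙ f) ▷ Y = (f' ▷ Y) ∙ (f ▷ Y).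
Proof. by rewrite -hcompM cmp1m. Qed.

Lemma hcompMr (A C D : B) (X : B C D) (Y Y' Y'' : B A C)
  (g' : Y' ⟶ Y'') (g : Y ⟶ Y') : X ◁ (g' ∙ g) = (X ◁ g') ∙ (X ◁ g).
Proof. by rewrite -hcompM cmp1m. Qed.

Lemma interchange (A C D : B) (X X' : B C D) (Y Y' : B A C)
  (f : X ⟶ X') (g : Y ⟶ Y') : (f ▷ Y') ∙ (X ◁ g) = (X' ◁ g) ∙ (f ▷ Y).
Proof. by rewrite -!hcompM !cmp1m !cmpm1. Qed.

Lemma ascV_nat (A C D E : B) (X X' : B D E) (Y Y' : B C D) (Z Z' : B A C)
    (f : X ⟶ X') (g : Y ⟶ Y') (h : Z ⟶ Z') :
  ((f ⊚ g) ⊚ h) ∙ (asc X Y Z)⁻¹ = (asc X' Y' Z')⁻¹ ∙ (f ⊚ (g ⊚ h)).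
Proof.
apply: (iso_injl (i := asc X' Y' Z')); apply: (iso_injr (i := asc X Y Z)).
by rewrite compVKl !cmpA bwdK cmpm1 asc_nat.
Qed.

Lemma hcomp_injl (A C : B) (X Y : B A C) (f g : X ⟶ Y) :
  id1 C ◁ f = id1 C ◁ g -> f = g.
Proof.
by move=> e; apply: (iso_injr (i := lun X)); rewrite -!lun_nat e.
Qed.

Lemma hcomp_injr (A C : B) (X Y : B A C) (f g : X ⟶ Y) :
  f ▷ id1 A = g ▷ id1 A -> f = g.
Proof.
by move=> e; apply: (iso_injr (i := run X)); rewrite -!run_nat e.
Qed.

Lemma lun_comp (A C D : B) (X : B C D) (Y : B A C) :
  lun (X ∘ Y) ∙ asc (id1 D) X Y = lun X ▷ Y.
Proof.
apply: hcomp_injl.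
apply: (iso_injr (i := comp_iso (asc (id1 D) (id1 D ∘ X) Y)
                     (hcomp_iso (asc (id1 D) (id1 D) X) (id_iso Y)))) => /=.
rewrite hcompMr !cmpA -pentagon -[LHS]cmpA triangle -hcomp1 -asc_nat.
by rewrite -triangle hcompMl -cmpA asc_nat cmpA.
Qed.

Lemma run_comp (A C D : B) (X : B C D) (Y : B A C) :
  (X ◁ run Y) ∙ asc X Y (id1 A) = run (X ∘ Y).
Proof.
apply: hcomp_injr; apply: (iso_injl (i := asc X Y (id1 A))).
rewrite hcompMl -cmpA asc_nat -triangle hcompMr !cmpA -pentagon.
by rewrite -cmpA -asc_nat hcomp1 cmpA triangle.
Qed.

Lemma lun_run (A : B) : lun (id1 A) = run (id1 A) :> (_ ⟶ _).
Proof.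
apply: hcomp_injr; rewrite -lun_comp -triangle; congr (_ ∙ _).
by apply: (iso_injl (i := lun (id1 A))); rewrite lun_nat.
Qed.

Lemma pentagonV (A C D E G : B) (X : B E G) (Y : B D E) (Z : B C D)
    (W : B A C) :
  (asc X Y Z ▷ W) ∙ (asc (X ∘ Y) Z W)⁻¹ =
  (asc X (Y ∘ Z) W)⁻¹ ∙ (X ◁ (asc Y Z W)⁻¹) ∙ asc X Y (Z ∘ W).
Proof.
apply: (iso_injl (i := asc X (Y ∘ Z) W)); rewrite compVKl.
apply: (iso_injl (i := hcomp_iso (id_iso X) (asc Y Z W))) => /=.
rewrite -[RHS]cmpA -hcompM fwdK cmp1m hcomp1 cmp1m.
apply: (iso_injr (i := asc (X ∘ Y) Z W)).
by rewrite !cmpA bwdK cmpm1 pentagon.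
Qed.

Lemma re2 (C : lincat k) (X Y Z W : C) (f : Z ⟶ W) (g : Y ⟶ Z) (h : Y ⟶ W)
  (t : X ⟶ Y) : f ∙ g = h -> f ∙ g ∙ t = h ∙ t.
Proof. by move=> <-; rewrite cmpA. Qed.

Lemma re3 (C : lincat k) (X Y Z V W : C) (e : V ⟶ W) (f : Z ⟶ V) (g : Y ⟶ Z)
  (h : Y ⟶ W) (t : X ⟶ Y) : e ∙ f ∙ g = h -> e ∙ f ∙ g ∙ t = h ∙ t.
Proof. by move=> <-; rewrite !cmpA. Qed.

Lemma re5 (C : lincat k) (X Y Z V W P Q : C) (c : P ⟶ Q) (d : W ⟶ P)
  (e : V ⟶ W) (f : Z ⟶ V) (g : Y ⟶ Z) (h : Y ⟶ Q) (t : X ⟶ Y) :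
  c ∙ d ∙ e ∙ f ∙ g = h -> c ∙ d ∙ e ∙ f ∙ g ∙ t = h ∙ t.
Proof. by move=> <-; rewrite !cmpA. Qed.

Lemma asc_whiskV (A C D E G : B) (X : B E G) (Y : B D E) (Z : B C D)
    (W : B A C) :
  asc (X ∘ Y) Z W ∙ ((asc X Y Z)⁻¹ ▷ W) =
  (asc X Y (Z ∘ W))⁻¹ ∙ (X ◁ asc Y Z W) ∙ asc X (Y ∘ Z) W.
Proof.
apply: (iso_injl (i := asc X Y (Z ∘ W))); rewrite compVKl.
by rewrite -[LHS]cmpA pentagon !cmpA -hcompMl fwdK hcomp1 cmpm1.
Qed.

Lemma trans_comp_l (a0 a1 a2 c1 c2 d1 d2 : B)
    (GX : B c1 d1) (GY : B a1 c1) (HX : B c2 d2) (HY : B a2 c2)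
    (sA : B a0 a1) (tA : B a1 a2) (tC : B c1 c2) (tD : B d1 d2)
    (tX : HX ∘ tC ⟶ tD ∘ GX) (tY : HY ∘ tA ⟶ tC ∘ GY) :
  (tD ◁ asc GX GY sA) ∙ asc tD (GX ∘ GY) sA
    ∙ ((asc tD GX GY ∙ (tX ▷ GY) ∙ (asc HX tC GY)⁻¹
               ∙ (HX ◁ tY) ∙ asc HX HY tA) ▷ sA)
    ∙ (asc (HX ∘ HY) tA sA)⁻¹ =
  asc tD GX (GY ∘ sA) ∙ (tX ▷ (GY ∘ sA)) ∙ (asc HX tC (GY ∘ sA))⁻¹
    ∙ (HX ◁ asc tC GY sA) ∙ (HX ◁ (tY ▷ sA)) ∙ (HX ◁ (asc HY tA sA)⁻¹)
    ∙ asc HX HY (tA ∘ sA).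
Proof.
apply: (iso_injr (i := asc (HX ∘ HY) tA sA)).
rewrite !cmpA bwdK cmpm1 pentagon.
have K : (HX ◁ (asc HY tA sA)⁻¹) ∙ (HX ◁ asc HY tA sA) = idm _.
  by rewrite -hcompMr bwdK hcomp1.
rewrite (re2 _ K) cmp1m !hcompMl (re3 _ (esym (pentagon _ _ _ _))) !cmpA.
rewrite (re2 _ (asc_nat _ _ _)) hcomp1 !cmpA.
do 2 congr (_ ∙ _).
by rewrite (re2 _ (asc_whiskV _ _ _ _)) !cmpA (re2 _ (asc_nat _ _ _)) !cmpA.
Qed.

Lemma trans_comp_r (a0 c0 c1 c2 d0 d1 d2 : B)
    (FX : B c0 d0) (FY : B a0 c0) (GX : B c1 d1) (HX : B c2 d2)
    (sC : B c0 c1) (sD : B d0 d1) (tC : B c1 c2) (tD : B d1 d2)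
    (sX : GX ∘ sC ⟶ sD ∘ FX) (tX : HX ∘ tC ⟶ tD ∘ GX) :
  asc tD sD (FX ∘ FY) ∙ asc (tD ∘ sD) FX FY
    ∙ (((asc tD sD FX)⁻¹ ∙ (tD ◁ sX) ∙ asc tD GX sC ∙ (tX ▷ sC)
               ∙ (asc HX tC sC)⁻¹) ▷ FY)
    ∙ (asc HX (tC ∘ sC) FY)⁻¹ ∙ (HX ◁ (asc tC sC FY)⁻¹) =
  (tD ◁ asc sD FX FY) ∙ (tD ◁ (sX ▷ FY)) ∙ (tD ◁ (asc GX sC FY)⁻¹)
    ∙ asc tD GX (sC ∘ FY) ∙ (tX ▷ (sC ∘ FY)) ∙ (asc HX tC (sC ∘ FY))⁻¹.
Proof.
rewrite (re2 _ (pentagon _ _ _ _)) !hcompMl !cmpA.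
have K : (asc tD sD FX ▷ FY) ∙ ((asc tD sD FX)⁻¹ ▷ FY) = idm _.
  by rewrite -hcompMl fwdK hcomp1.
rewrite (re2 _ K) cmp1m (re2 _ (asc_nat _ _ _)) !cmpA.
do 2 congr (_ ∙ _).
have E : ((asc HX tC sC)⁻¹ ▷ FY) ∙ (asc HX (tC ∘ sC) FY)⁻¹
    ∙ (HX ◁ (asc tC sC FY)⁻¹) =
  (asc (HX ∘ tC) sC FY)⁻¹ ∙ (asc HX tC (sC ∘ FY))⁻¹.
  apply: (iso_injl (i := hcomp_iso (asc HX tC sC) (id_iso FY))) => /=.
  rewrite -[LHS]cmpA -hcompMl fwdK hcomp1 cmp1m -[RHS]cmpA pentagonV !cmpA.
  by rewrite fwdK cmpm1.
rewrite E (re2 _ (ascV_nat _ _ _)) !cmpA hcomp1.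
have E' : (asc tD GX sC ▷ FY) ∙ (asc (tD ∘ GX) sC FY)⁻¹ =
  (asc tD (GX ∘ sC) FY)⁻¹ ∙ (tD ◁ (asc GX sC FY)⁻¹) ∙ asc tD GX (sC ∘ FY).
  exact: pentagonV.
by rewrite (re2 _ E') !cmpA compVKl.
Qed.

(* The composition axiom of a composite of two transformations. *)
Lemma trans_comp (a0 a1 a2 c0 c1 c2 d0 d1 d2 : B)
    (FX : B c0 d0) (FY : B a0 c0) (GX : B c1 d1) (GY : B a1 c1)
    (HX : B c2 d2) (HY : B a2 c2)
    (sA : B a0 a1) (sC : B c0 c1) (sD : B d0 d1)
    (tA : B a1 a2) (tC : B c1 c2) (tD : B d1 d2)
    (sX : GX ∘ sC ⟶ sD ∘ FX) (sY : GY ∘ sA ⟶ sC ∘ FY)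
    (tX : HX ∘ tC ⟶ tD ∘ GX) (tY : HY ∘ tA ⟶ tC ∘ GY) :
  (asc tD sD (FX ∘ FY))⁻¹
    ∙ (tD ◁ (asc sD FX FY ∙ (sX ▷ FY) ∙ (asc GX sC FY)⁻¹
               ∙ (GX ◁ sY) ∙ asc GX GY sA))
    ∙ asc tD (GX ∘ GY) sA
    ∙ ((asc tD GX GY ∙ (tX ▷ GY) ∙ (asc HX tC GY)⁻¹
               ∙ (HX ◁ tY) ∙ asc HX HY tA) ▷ sA)
    ∙ (asc (HX ∘ HY) tA sA)⁻¹ =
  asc (tD ∘ sD) FX FY
    ∙ (((asc tD sD FX)⁻¹ ∙ (tD ◁ sX) ∙ asc tD GX sC ∙ (tX ▷ sC)
               ∙ (asc HX tC sC)⁻¹) ▷ FY)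
    ∙ (asc HX (tC ∘ sC) FY)⁻¹
    ∙ (HX ◁ ((asc tC sC FY)⁻¹ ∙ (tC ◁ sY) ∙ asc tC GY sA ∙ (tY ▷ sA)
               ∙ (asc HY tA sA)⁻¹))
    ∙ asc HX HY (tA ∘ sA).
Proof.
apply: (iso_injl (i := asc tD sD (FX ∘ FY))); rewrite compVKl.
rewrite !(hcompMr tD) !(hcompMr HX) !cmpA trans_comp_l.
rewrite (re5 _ (trans_comp_r _ _ _)) !cmpA; do 3 congr (_ ∙ _).
rewrite (re2 _ (esym (ascV_nat _ _ _))) hcomp1 !cmpA (re2 _ (interchange _ _)) !cmpA.
by rewrite -(hcomp1 tD GX) (re2 _ (asc_nat _ _ _)) !cmpA.
Qed.

Lemma trans_unit (a0 a1 a2 : B) (s : B a0 a1) (t : B a1 a2) :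
  (asc t s (id1 a0))⁻¹ ∙ (t ◁ ((run s)⁻¹ ∙ lun s)) ∙ asc t (id1 a1) s
    ∙ (((run t)⁻¹ ∙ lun t) ▷ s) ∙ (asc (id1 a2) t s)⁻¹ =
  (run (t ∘ s))⁻¹ ∙ lun (t ∘ s).
Proof.
apply: (iso_injl (i := run (t ∘ s))); rewrite compVKl.
apply: (iso_injr (i := asc (id1 a2) t s)); rewrite lun_comp -run_comp.
rewrite !hcompMl !hcompMr !cmpA bwdK cmpm1 compVKl.
have K : (t ◁ run s) ∙ (t ◁ (run s)⁻¹) = idm _.
  by rewrite -hcompMr fwdK hcomp1.
rewrite (re2 _ K) cmp1m -[LHS]cmpA triangle -cmpA -hcompMl fwdK hcomp1.
by rewrite cmp1m.
Qed.

End Coherence.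

Section Transformations.
Variables (k : fieldType) (B Bt : bicat k).
Implicit Types F G H : pseudofun B Bt.

Record pntrans F G := PNTrans {
  pt0 :> forall A : B, Bt (F A) (G A);
  pt1 : forall (A C : B) (X : B A C), iso (G⟨X⟩ ∘ pt0 A) (pt0 C ∘ F⟨X⟩);
  pt_nat : forall (A C : B) (X Y : B A C) (f : X ⟶ Y),
    pt1 Y ∙ (G⟪f⟫ ▷ pt0 A) = (pt0 C ◁ F⟪f⟫) ∙ pt1 X;
  pt_comp : forall (A C D : B) (X : B C D) (Y : B A C),
    pt1 (X ∘ Y) ∙ (pfa G X Y ▷ pt0 A) =
    (pt0 D ◁ pfa F X Y) ∙ asc (pt0 D) F⟨X⟩ F⟨Y⟩ ∙ (pt1 X ▷ F⟨Y⟩)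
      ∙ (asc G⟨X⟩ (pt0 C) F⟨Y⟩)⁻¹ ∙ (G⟨X⟩ ◁ pt1 Y) ∙ asc G⟨X⟩ G⟨Y⟩ (pt0 A);
  pt_unit : forall A : B,
    pt1 (id1 A) ∙ (pfu G A ▷ pt0 A) =
    (pt0 A ◁ pfu F A) ∙ (run (pt0 A))⁻¹ ∙ lun (pt0 A) }.

Definition id_pt F : pntrans F F.
Proof.
refine (@PNTrans F F (fun A => id1 (F A))
  (fun A C X => comp_iso (inv_iso (lun F⟨X⟩)) (run F⟨X⟩)) _ _ _) => /=.
- move=> A C X Y f; rewrite cmpA run_nat; apply: (iso_injl (i := lun F⟨Y⟩)).
  by rewrite compVKl -[RHS]cmpA lun_nat cmpA compVKl.
- move=> A C D X Y; rewrite cmpA run_nat hcompMl hcompMr !cmpA run_comp.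
  apply: (iso_injl (i := lun F⟨X ∘ Y⟩)).
  rewrite compVKl -[RHS]cmpA lun_nat !cmpA; congr (_ ∙ _).
  have E : (run F⟨X⟩ ▷ F⟨Y⟩) ∙ (asc F⟨X⟩ (id1 (F C)) F⟨Y⟩)⁻¹
      ∙ (F⟨X⟩ ◁ (lun F⟨Y⟩)⁻¹) = idm _.
    rewrite -triangle !cmpA compVKl -hcompMr fwdK; exact: hcomp1.
  rewrite (re3 _ E) cmp1m (re2 _ (lun_comp _ _)) -[RHS]cmpA -hcompMl.
  by rewrite fwdK hcomp1 cmp1m.
- move=> A; rewrite cmpA run_nat; apply: (iso_injl (i := lun F⟨id1 A⟩)).
  rewrite compVKl -[RHS]cmpA lun_nat !cmpA lun_run.
  by rewrite compVKl.
Defined.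

Definition comp_pt F G H (t : pntrans G H) (s : pntrans F G) : pntrans F H.
Proof.
refine (@PNTrans F H (fun A => t A ∘ s A)
  (fun A C X =>
     comp_iso (inv_iso (asc (t C) (s C) F⟨X⟩))
    (comp_iso (hcomp_iso (id_iso (t C)) (pt1 s X))
    (comp_iso (asc (t C) G⟨X⟩ (s A))
    (comp_iso (hcomp_iso (pt1 t X) (id_iso (s A)))
              (inv_iso (asc H⟨X⟩ (t A) (s A))))))) _ _ _) => /=.
- move=> A C X Y f.
  rewrite !cmpA -(hcomp1 (t A) (s A)) -ascV_nat.
  have E1 : (pt1 t Y ▷ s A) ∙ ((H⟪f⟫ ▷ t A) ▷ s A) =
      ((t C ◁ G⟪f⟫) ▷ s A) ∙ (pt1 t X ▷ s A) by rewrite -!hcompMl pt_nat.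
  have E2 : (t C ◁ pt1 s Y) ∙ (t C ◁ (G⟪f⟫ ▷ s A)) =
      (t C ◁ (s C ◁ F⟪f⟫)) ∙ (t C ◁ pt1 s X) by rewrite -!hcompMr pt_nat.
  rewrite (re2 _ E1) !cmpA (re2 _ (asc_nat _ _ _)) !cmpA (re2 _ E2) !cmpA.
  by rewrite (re2 _ (esym (ascV_nat _ _ _))) hcomp1 !cmpA.
- move=> A C D X Y.
  rewrite !cmpA -(hcomp1 (t A) (s A)) -ascV_nat.
  rewrite -[in LHS](cmpA (pt1 t _ ▷ s A)) -hcompMl pt_comp hcompMl !cmpA.
  rewrite (re2 _ (asc_nat _ _ _)) !cmpA.
  rewrite -[in LHS](cmpA (t D ◁ pt1 s _)) -hcompMr pt_comp hcompMr !cmpA.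
  rewrite (re2 _ (esym (ascV_nat _ _ _))) hcomp1 !cmpA; congr (_ ∙ _).
  by rewrite -trans_comp !hcompMl !hcompMr !cmpA.
- move=> A.
  rewrite !cmpA -(hcomp1 (t A) (s A)) -ascV_nat.
  rewrite -[in LHS](cmpA (pt1 t _ ▷ s A)) -hcompMl pt_unit hcompMl !cmpA.
  rewrite (re2 _ (asc_nat _ _ _)) !cmpA.
  rewrite -[in LHS](cmpA (t A ◁ pt1 s _)) -hcompMr pt_unit hcompMr !cmpA.
  rewrite (re2 _ (esym (ascV_nat _ _ _))) hcomp1 !cmpA; congr (_ ∙ _).
  exact: trans_unit.
Defined.

Record modification F G (s t : pntrans F G) := Modification {
  md :> forall A : B, s A ⟶ t A;
  md_nat : forall (A C : B) (X : B A C),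
    (md C ▷ F⟨X⟩) ∙ pt1 s X = pt1 t X ∙ (G⟨X⟩ ◁ md A) }.

Definition is_invertible F G (s t : pntrans F G) (m : modification s t) :=
  forall A : B, is_iso (m A).

Definition modiso F G (s t : pntrans F G) : Prop :=
  exists m : modification s t, is_invertible m.

Definition mutually_inverse F G (s : pntrans F G) (t : pntrans G F) : Prop :=
  modiso (comp_pt t s) (id_pt F) /\ modiso (comp_pt s t) (id_pt G).

Definition pn_equivalent F G : Prop :=
  exists (s : pntrans F G) (t : pntrans G F), mutually_inverse s t.

End Transformations.

Section Biequivalences.
Variables (k : fieldType) (B Bt : bicat k).

Definition quasi_inverse (F : pseudofun B Bt) (G : pseudofun Bt B) : Prop :=
  pn_equivalent (comp_pf G F) (id_pf B) /\
  pn_equivalent (comp_pf F G) (id_pf Bt).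

Definition is_biequivalence (F : pseudofun B Bt) : Prop :=
  exists G : pseudofun Bt B, quasi_inverse F G.

(* The choices on which the induced functor on centers depends. *)
Record biequiv_data (F : pseudofun B Bt) := BiequivData {
  bG : pseudofun Bt B;
  bG_inv : quasi_inverse F bG;
  bchi : pntrans (comp_pf F bG) (id_pf Bt);
  btau : pntrans (id_pf Bt) (comp_pf F bG);
  bchi_tau : mutually_inverse bchi btau;
  bomega : modification (comp_pt btau bchi) (id_pt (comp_pf F bG));
  bomega_inv : is_invertible bomega }.

End Biequivalences.

Record moncat (k : fieldType) := MonCat {
  mcat :> lincat k;
  munit : mcat;
  mten : mcat -> mcat -> mcat;
  mtenm : forall X X' Y Y' : mcat,
    X ⟶ X' -> Y ⟶ Y' -> mten X Y ⟶ mten X' Y';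
  mtenm1 : forall X Y, mtenm (idm X) (idm Y) = idm (mten X Y);
  mtenmM : forall X X' X'' Y Y' Y'' (f' : X' ⟶ X'') (f : X ⟶ X')
      (g' : Y' ⟶ Y'') (g : Y ⟶ Y'),
    mtenm (f' ∙ f) (g' ∙ g) = mtenm f' g' ∙ mtenm f g;
  mtenmDl : forall X X' Y Y' (f f' : X ⟶ X') (g : Y ⟶ Y'),
    mtenm (f + f') g = mtenm f g + mtenm f' g;
  mtenmZl : forall X X' Y Y' c (f : X ⟶ X') (g : Y ⟶ Y'),
    mtenm (c *: f) g = c *: mtenm f g;
  mtenmDr : forall X X' Y Y' (f : X ⟶ X') (g g' : Y ⟶ Y'),
    mtenm f (g + g') = mtenm f g + mtenm f g';
  mtenmZr : forall X X' Y Y' c (f : X ⟶ X') (g : Y ⟶ Y'),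
    mtenm f (c *: g) = c *: mtenm f g;
  masc : forall X Y Z, iso (mten (mten X Y) Z) (mten X (mten Y Z));
  mlun : forall X, iso (mten munit X) X;
  mrun : forall X, iso (mten X munit) X;
  masc_nat : forall X X' Y Y' Z Z' (f : X ⟶ X') (g : Y ⟶ Y') (h : Z ⟶ Z'),
    masc X' Y' Z' ∙ mtenm (mtenm f g) h = mtenm f (mtenm g h) ∙ masc X Y Z;
  mlun_nat : forall X Y (f : X ⟶ Y),
    mlun Y ∙ mtenm (idm munit) f = f ∙ mlun X;
  mrun_nat : forall X Y (f : X ⟶ Y),
    mrun Y ∙ mtenm f (idm munit) = f ∙ mrun X;
  mpentagon : forall X Y Z W,
    masc X Y (mten Z W) ∙ masc (mten X Y) Z W =
    mtenm (idm X) (masc Y Z W) ∙ masc X (mten Y Z) W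
      ∙ mtenm (masc X Y Z) (idm W);
  mtriangle : forall X Y,
    mtenm (idm X) (mlun Y) ∙ masc X munit Y = mtenm (mrun X) (idm Y) }.

Arguments munit {k} m.
Arguments masc {k m} X Y Z.
Arguments mlun {k m} X.
Arguments mrun {k m} X.

Notation "X ⊗ Y" := (mten X Y).
Notation "f ⊠ g" := (mtenm f g).

Section MonoidalFunctors.
Variables (k : fieldType) (C D : moncat k).

Record is_monoidal_functor (F : functor_data C D)
    (J : forall X Y : C, F X ⊗ F Y ⟶ F (X ⊗ Y)) : Prop := IsMonoidalFunctor {
  mf_linfun : is_linfun F;
  mf_iso : forall X Y, is_iso (J X Y);
  mf_nat : forall (X X' Y Y' : C) (f : X ⟶ X') (g : Y ⟶ Y'),
    J X' Y' ∙ (fmap F f ⊠ fmap F g) = fmap F (f ⊠ g) ∙ J X Y;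
  mf_asc : forall X Y Z : C,
    fmap F (masc X Y Z) ∙ J (X ⊗ Y) Z ∙ (J X Y ⊠ idm (F Z)) =
    J X (Y ⊗ Z) ∙ (idm (F X) ⊠ J Y Z) ∙ masc (F X) (F Y) (F Z);
  mf_unit : exists e : iso (munit D) (F (munit C)), forall X : C,
    fmap F (mlun X) ∙ J (munit C) X ∙ (e ⊠ idm (F X)) = mlun (F X) /\
    fmap F (mrun X) ∙ J X (munit C) ∙ (idm (F X) ⊠ e) = mrun (F X) }.

Definition is_monoidal_equivalence (F : functor_data C D)
    (J : forall X Y : C, F X ⊗ F Y ⟶ F (X ⊗ Y)) : Prop :=
  is_monoidal_functor J /\ is_equivalence F.

End MonoidalFunctors.

Section Center.
Variables (k : fieldType) (B : bicat k).

Record halfbraid := HalfBraid {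
  hv :> forall A : B, B A A;
  hs : forall (A C : B) (X : B A C), hv C ∘ X ⟶ X ∘ hv A }.

Record is_halfbraid (V : halfbraid) : Prop := IsHalfBraid {
  hs_iso : forall (A C : B) (X : B A C), is_iso (hs V X);
  hs_nat : forall (A C : B) (X Y : B A C) (f : X ⟶ Y),
    hs V Y ∙ (V C ◁ f) = (f ▷ V A) ∙ hs V X;
  hs_unit : forall A : B,
    hs V (id1 A) = (lun (V A))⁻¹ ∙ run (V A);
  hs_comp : forall (A C D : B) (X : B C D) (Y : B A C),
    hs V (X ∘ Y) =
    (asc X Y (V A))⁻¹ ∙ (X ◁ hs V Y) ∙ asc X (V C) Y ∙ (hs V X ▷ Y)
      ∙ (asc (V D) X Y)⁻¹ }.

Record center_ob := CenterOb {
  zdata :> halfbraid;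
  zlaw : is_halfbraid zdata }.

Definition is_center_hom (V W : halfbraid) (f : forall A : B, V A ⟶ W A) :=
  forall (A C : B) (X : B A C), (X ◁ f A) ∙ hs V X = hs W X ∙ (f C ▷ X).

Record center_hom (V W : halfbraid) := CenterHom {
  zmap :> forall A : B, V A ⟶ W A;
  zmapP : is_center_hom zmap }.

Lemma center_hom_eq (V W : halfbraid) (f g : center_hom V W) :
  (forall A, f A = g A) -> f = g.
Proof.
case: f g => [f fP] [g gP] /= e.
have {}e : f = g by apply: functional_extensionality_dep.
by rewrite e in fP *; congr CenterHom; apply: Prop_irrelevance.
Qed.

Section CenterHom.
Variables V W : halfbraid.
Implicit Types f g h : center_hom V W.

Lemma hcompl0 (A C D : B) (X X' : B C D) (Y Y' : B A C) (f : X ⟶ X') :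
  f ⊚ (0 : Y ⟶ Y') = 0.
Proof. by rewrite -[in LHS](scale0r (0 : Y ⟶ Y')) hcompZr scale0r. Qed.

Lemma hcompr0 (A C D : B) (X X' : B C D) (Y Y' : B A C) (g : Y ⟶ Y') :
  (0 : X ⟶ X') ⊚ g = 0.
Proof. by rewrite -[in LHS](scale0r (0 : X ⟶ X')) hcompZl scale0r. Qed.

Lemma cmpl0 (C : lincat k) (X Y Z : C) (f : Y ⟶ Z) : f ∙ (0 : X ⟶ Y) = 0.
Proof. by rewrite -[in LHS](scale0r (0 : X ⟶ Y)) cmpZr scale0r. Qed.

Lemma cmpr0 (C : lincat k) (X Y Z : C) (g : X ⟶ Y) : (0 : Y ⟶ Z) ∙ g = 0.
Proof. by rewrite -[in LHS](scale0r (0 : Y ⟶ Z)) cmpZl scale0r. Qed.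

Fact ch0P : @is_center_hom V W (fun A => 0).
Proof. by move=> A C X; rewrite hcompl0 hcompr0 cmpl0 cmpr0. Qed.

Fact chDP f g : is_center_hom (fun A => f A + g A).
Proof.
by move=> A C X; rewrite hcompDl hcompDr cmpDl cmpDr !zmapP.
Qed.

Fact chZP c f : is_center_hom (fun A => c *: f A).
Proof. by move=> A C X; rewrite hcompZl hcompZr cmpZl cmpZr zmapP. Qed.

HB.instance Definition _ := gen_eqMixin (center_hom V W).
HB.instance Definition _ := gen_choiceMixin (center_hom V W).

Definition ch0 := CenterHom ch0P.
Definition chD f g := CenterHom (chDP f g).
Definition chZ c f := CenterHom (chZP c f).

Fact chDA : associative chD.
Proof. by move=> f g h; apply: center_hom_eq => A; apply: addrA. Qed.
Fact chDC : commutative chD.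
Proof. by move=> f g; apply: center_hom_eq => A; apply: addrC. Qed.
Fact ch0D : left_id ch0 chD.
Proof. by move=> f; apply: center_hom_eq => A; apply: add0r. Qed.
Fact chND : left_inverse ch0 (chZ (-1)) chD.
Proof.
by move=> f; apply: center_hom_eq => A /=; rewrite scaleN1r addNr.
Qed.

HB.instance Definition _ :=
  GRing.isZmodule.Build (center_hom V W) chDA chDC ch0D chND.

Fact chZA c d f : chZ c (chZ d f) = chZ (c * d) f.
Proof. by apply: center_hom_eq => A; apply: scalerA. Qed.
Fact ch1Z : left_id 1 chZ.
Proof. by move=> f; apply: center_hom_eq => A; apply: scale1r. Qed.
Fact chZDr : right_distributive chZ +%R.
Proof. by move=> c f g; apply: center_hom_eq => A; apply: scalerDr. Qed.
Fact chZDl f : {morph chZ^~ f : c d / c + d}.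
Proof. by move=> c d; apply: center_hom_eq => A; apply: scalerDl. Qed.

HB.instance Definition _ :=
  GRing.Zmodule_isLmodule.Build k (center_hom V W) chZA ch1Z chZDr chZDl.

End CenterHom.

Fact ch1P (V : halfbraid) : @is_center_hom V V (fun A => idm (V A)).
Proof. by move=> A C X; rewrite !hcomp1 cmp1m cmpm1. Qed.

Fact chMP (U V W : halfbraid) (f : center_hom V W) (g : center_hom U V) :
  is_center_hom (fun A => f A ∙ g A).
Proof.
move=> A C X.
by rewrite hcompMr hcompMl cmpA zmapP -cmpA zmapP cmpA.
Qed.

Definition center_cat : lincat k.
Proof.
refine (@LinCat k center_ob (fun V W => center_hom V W)
  (fun V => CenterHom (@ch1P V)) (fun U V W f g => CenterHom (chMP f g))
  _ _ _ _ _ _ _) => *; apply: center_hom_eq => A /=.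
- exact: cmpA.
- exact: cmp1m.
- exact: cmpm1.
- exact: cmpDl.
- exact: cmpZl.
- exact: cmpDr.
- exact: cmpZr.
Defined.

Definition ten_hb (V W : halfbraid) : halfbraid :=
  @HalfBraid (fun A => V A ∘ W A)
    (fun A C X => asc X (V A) (W A) ∙ (hs V X ▷ W A) ∙ (asc (V C) X (W A))⁻¹
       ∙ (V C ◁ hs W X) ∙ asc (V C) (W C) X).

Definition unit_hb : halfbraid :=
  @HalfBraid (fun A => id1 A) (fun A C X => (run X)⁻¹ ∙ lun X).

Lemma iso_bwd (C : lincat k) (X Y : C) (i j : iso X Y) :
  fwd i = fwd j -> i⁻¹ = j⁻¹.
Proof. by move=> e; rewrite -[LHS]cmpm1 -(fwdK j) -e compKl. Qed.

Fact unit_hbP : is_halfbraid unit_hb.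
Proof.
split=> /=.
- by move=> A C X; exact: (is_isoP (comp_iso (inv_iso (run X)) (lun X))).
- move=> A C X Y f; rewrite cmpA lun_nat; apply: (iso_injl (i := run Y)).
  by rewrite compVKl -[RHS]cmpA run_nat cmpA compVKl.
- by move=> A; apply: (iso_injl (i := run (id1 A))); rewrite compVKl -{1}lun_run compVKl lun_run.
- by move=> A C D X Y; rewrite -trans_unit.
Qed.

Lemma trans_compV (a c d : B) (X : B c d) (Y : B a c)
    (VA WA : B a a) (VC WC : B c c) (VD WD : B d d)
    (vX : iso (VD ∘ X) (X ∘ VC)) (vY : iso (VC ∘ Y) (Y ∘ VA))
    (wX : iso (WD ∘ X) (X ∘ WC)) (wY : iso (WC ∘ Y) (Y ∘ WA)) :
  asc (X ∘ Y) VA WA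
    ∙ (((asc X Y VA)⁻¹ ∙ (X ◁ vY) ∙ asc X VC Y ∙ (vX ▷ Y)
          ∙ (asc VD X Y)⁻¹) ▷ WA)
    ∙ (asc VD (X ∘ Y) WA)⁻¹
    ∙ (VD ◁ ((asc X Y WA)⁻¹ ∙ (X ◁ wY) ∙ asc X WC Y ∙ (wX ▷ Y)
          ∙ (asc WD X Y)⁻¹))
    ∙ asc VD WD (X ∘ Y) =
  (asc X Y (VA ∘ WA))⁻¹
    ∙ (X ◁ (asc Y VA WA ∙ (vY ▷ WA) ∙ (asc VC Y WA)⁻¹ ∙ (VC ◁ wY)
          ∙ asc VC WC Y))
    ∙ asc X (VC ∘ WC) Y
    ∙ ((asc X VC WC ∙ (vX ▷ WC) ∙ (asc VD X WC)⁻¹ ∙ (VD ◁ wX)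
          ∙ asc VD WD X) ▷ Y)
    ∙ (asc (VD ∘ WD) X Y)⁻¹.
Proof.
pose ex (A C D : B) (X' : B C D) (Y' : B A C) U1 U2 U3
  (x : iso (U1 ∘ X') (X' ∘ U2)) (y : iso (U2 ∘ Y') (Y' ∘ U3)) :=
  comp_iso (asc U1 X' Y') (comp_iso (hcomp_iso (inv_iso x) (id_iso Y'))
  (comp_iso (inv_iso (asc X' U2 Y')) (comp_iso (hcomp_iso (id_iso X')
  (inv_iso y)) (asc X' Y' U3)))).
pose tn (A C : B) (X' : B A C) U1 U2 U1' U2'
  (x : iso (U1 ∘ X') (X' ∘ U2)) (x' : iso (U1' ∘ X') (X' ∘ U2')) :=
  comp_iso (inv_iso (asc U1 U1' X'))
  (comp_iso (hcomp_iso (id_iso U1) (inv_iso x'))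
  (comp_iso (asc U1 X' U2') (comp_iso (hcomp_iso (inv_iso x) (id_iso U2'))
  (inv_iso (asc X' U2 U2'))))).
pose i := comp_iso (inv_iso (asc VD WD (X ∘ Y)))
  (comp_iso (hcomp_iso (id_iso VD) (ex _ _ _ _ _ _ _ _ wX wY))
  (comp_iso (asc VD (X ∘ Y) WA)
  (comp_iso (hcomp_iso (ex _ _ _ _ _ _ _ _ vX vY) (id_iso WA))
  (inv_iso (asc (X ∘ Y) VA WA))))).
pose j := comp_iso (asc (VD ∘ WD) X Y)
  (comp_iso (hcomp_iso (tn _ _ _ _ _ _ _ vX wX) (id_iso Y))
  (comp_iso (inv_iso (asc X (VC ∘ WC) Y))
  (comp_iso (hcomp_iso (id_iso X) (tn _ _ _ _ _ _ _ vY wY))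
  (asc X Y (VA ∘ WA))))).
have e : fwd i = fwd j by exact: trans_comp.
by have := iso_bwd e; rewrite /= !cmpA.
Qed.

Fact ten_hbP (V W : halfbraid) :
  is_halfbraid V -> is_halfbraid W -> is_halfbraid (ten_hb V W).
Proof.
move=> hV hW; split=> /=.
- move=> A C X.
  have a1 := is_isoP (asc X (V A) (W A)).
  have a2 := is_isoP (inv_iso (asc (V C) X (W A))).
  have a3 := is_isoP (asc (V C) (W C) X).
  have b1 : is_iso (hs V X ▷ W A).
    by apply: is_iso_hcomp; [exact: hs_iso | exact: (is_isoP (id_iso _))].
  have b2 : is_iso (V C ◁ hs W X).
    by apply: is_iso_hcomp; [exact: (is_isoP (id_iso _)) | exact: hs_iso].
  by repeat apply: is_iso_comp.
- move=> A C X Y f.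
  have E1 : (hs V Y ▷ W A) ∙ ((V C ◁ f) ▷ W A) =
      ((f ▷ V A) ▷ W A) ∙ (hs V X ▷ W A) by rewrite -!hcompMl hs_nat.
  have E2 : (V C ◁ hs W Y) ∙ (V C ◁ (W C ◁ f)) =
      (V C ◁ (f ▷ W A)) ∙ (V C ◁ hs W X) by rewrite -!hcompMr hs_nat.
  rewrite !cmpA -(hcomp1 (V C) (W C)) asc_nat (re2 _ E2) !cmpA.
  rewrite (re2 _ (esym (ascV_nat _ _ _))) !cmpA (re2 _ E1) !cmpA.
  by rewrite (re2 _ (asc_nat _ _ _)) hcomp1 !cmpA.
- move=> A; rewrite !hs_unit //.
  pose i := comp_iso (inv_iso (asc (V A) (W A) (id1 A)))
    (comp_iso (hcomp_iso (id_iso (V A))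
                 (comp_iso (inv_iso (run (W A))) (lun (W A))))
    (comp_iso (asc (V A) (id1 A) (W A))
    (comp_iso (hcomp_iso (comp_iso (inv_iso (run (V A))) (lun (V A)))
                 (id_iso (W A)))
       (inv_iso (asc (id1 A) (V A) (W A)))))).
  pose j := comp_iso (inv_iso (run (V A ∘ W A))) (lun (V A ∘ W A)).
  by rewrite -[RHS]/(j⁻¹) -(iso_bwd (trans_unit _ _ : fwd i = fwd j)) /= !cmpA.
- move=> A C D X Y.
  have [vX [vX1 vX2]] := hs_iso hV X; have [vY [vY1 vY2]] := hs_iso hV Y.
  have [wX [wX1 wX2]] := hs_iso hW X; have [wY [wY1 wY2]] := hs_iso hW Y.
  rewrite !hs_comp //.
  exact: (trans_compV (Iso vX1 vX2) (Iso vY1 vY2) (Iso wX1 wX2) (Iso wY1 wY2)).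
Qed.

Definition center_ten (V W : center_ob) : center_ob :=
  CenterOb (ten_hbP (zlaw V) (zlaw W)).

Definition center_unit : center_ob := CenterOb unit_hbP.

Fact ch_tenP (V V' W W' : halfbraid) (f : center_hom V V')
  (g : center_hom W W') :
  @is_center_hom (ten_hb V W) (ten_hb V' W') (fun A => f A ⊚ g A).
Proof.
move=> A C X /=.
have E1 : ((X ◁ f A) ⊚ g A) ∙ (hs V X ▷ W A) =
    (hs V' X ▷ W' A) ∙ ((f C ▷ X) ⊚ g A).
  by rewrite -!hcompM zmapP cmp1m cmpm1.
have E2 : (f C ⊚ (X ◁ g A)) ∙ (V C ◁ hs W X) =
    (V' C ◁ hs W' X) ∙ (f C ⊚ (g C ▷ X)).
  by rewrite -!hcompM zmapP cmp1m cmpm1.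
rewrite (re2 _ (esym (asc_nat _ _ _))) !cmpA (re2 _ E1) !cmpA.
by rewrite (re2 _ (ascV_nat _ _ _)) !cmpA (re2 _ E2) !cmpA asc_nat.
Qed.

Definition center_tenm (V V' W W' : center_ob) (f : center_hom V V')
    (g : center_hom W W') : center_hom (center_ten V W) (center_ten V' W') :=
  CenterHom (ch_tenP f g).

Lemma center_isoP (V W : center_ob) (i : forall A, iso (V A) (W A)) :
  @is_center_hom V W i -> @is_center_hom W V (fun A => (i A)⁻¹).
Proof.
move=> h A C X.
apply: (iso_injl (i := hcomp_iso (id_iso X) (i A))) => /=.
rewrite -[LHS]cmpA -hcompMr fwdK hcomp1 cmp1m -[RHS]cmpA h cmpA -hcompMl fwdK.
by rewrite hcomp1 cmpm1.
Qed.

Definition center_iso (V W : center_ob) (i : forall A, iso (V A) (W A))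
  (h : @is_center_hom V W i) : @iso k center_cat V W.
Proof.
exists (CenterHom h) (CenterHom (center_isoP h)).
- by apply: center_hom_eq => A; apply: bwdK.
- by apply: center_hom_eq => A; apply: fwdK.
Defined.

Fact center_ascP (U V W : center_ob) :
  @is_center_hom (center_ten (center_ten U V) W)
    (center_ten U (center_ten V W)) (fun A => asc (U A) (V A) (W A)).
Proof.
move=> A C X /=.
rewrite !hcompMl !hcompMr !cmpA (re3 _ (esym (pentagon _ _ _ _))) !cmpA.
rewrite (re2 _ (asc_nat _ _ _)) hcomp1 !cmpA; do 2 congr (_ ∙ _).
rewrite (re2 _ (asc_whiskV _ _ _ _)) !cmpA; do 2 congr (_ ∙ _).
rewrite (re2 _ (asc_nat _ _ _)) !cmpA; congr (_ ∙ _).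
rewrite (re2 _ (pentagonV _ _ _ _)) !cmpA compVKl; congr (_ ∙ _).
by rewrite -(hcomp1 (U C) (V C)) (re2 _ (asc_nat _ _ _)) !cmpA pentagon.
Qed.

Fact center_lunP (V : center_ob) :
  @is_center_hom (center_ten center_unit V) V (fun A => lun (V A)).
Proof.
move=> A C X /=.
have K : (run X ▷ V A) ∙ ((run X)⁻¹ ▷ V A) = idm _.
  by rewrite -hcompMl fwdK hcomp1.
rewrite (re2 _ (triangle _ _)) hcompMl !cmpA (re2 _ K) cmp1m -lun_comp !cmpA.
by rewrite compVKl (re2 _ (lun_nat _)) !cmpA lun_comp.
Qed.

Fact center_runP (V : center_ob) :
  @is_center_hom (center_ten V center_unit) V (fun A => run (V A)).
Proof.
move=> A C X /=.
have K : (V C ◁ run X) ∙ (V C ◁ (run X)⁻¹) = idm _.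
  by rewrite -hcompMr fwdK hcomp1.
rewrite (re2 _ (run_comp _ _)) (re2 _ (run_nat _)) -run_comp !cmpA compVKl.
by rewrite hcompMr !cmpA (re2 _ K) cmp1m triangle.
Qed.

Definition center : moncat k.
Proof.
refine (@MonCat k center_cat center_unit center_ten center_tenm
  _ _ _ _ _ _ (fun U V W => center_iso (center_ascP U V W))
  (fun V => center_iso (center_lunP V)) (fun V => center_iso (center_runP V))
  _ _ _ _ _) => *; apply: center_hom_eq => A /=.
- exact: hcomp1.
- exact: hcompM.
- exact: hcompDl.
- exact: hcompZl.
- exact: hcompDr.
- exact: hcompZr.
- exact: asc_nat.
- exact: lun_nat.
- exact: run_nat.
- exact: pentagon.
- exact: triangle.
Defined.

End Center.

Section InducedFunctor.
Variables (k : fieldType) (B Bt : bicat k) (F : pseudofun B Bt).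
Variable D : biequiv_data F.

Local Notation G := (bG D).
Local Notation chi := (bchi D).
Local Notation tau := (btau D).
Local Notation omega := (bomega D).

Definition Fhat0 (V : halfbraid B) (C : Bt) : Bt C C :=
  chi C ∘ (F⟨V (G C)⟩ ∘ tau C).

(* Up to the coherence cells, from the last line to the first: [tau_Y^-1],
   [alpha], [F sigma], [alpha^-1], [chi_Y^-1]. *)
Definition Fhat_hs (V : halfbraid B) (C E : Bt) (Y : Bt C E) :
    Fhat0 V E ∘ Y ⟶ Y ∘ Fhat0 V C :=
  asc Y (chi C) (F⟨V (G C)⟩ ∘ tau C)
    ∙ ((pt1 chi Y)⁻¹ ▷ (F⟨V (G C)⟩ ∘ tau C))
    ∙ (asc (chi E) F⟨G⟨Y⟩⟩ (F⟨V (G C)⟩ ∘ tau C))⁻¹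
    ∙ (chi E ◁ asc F⟨G⟨Y⟩⟩ F⟨V (G C)⟩ (tau C))
    ∙ (chi E ◁ ((pfa F G⟨Y⟩ (V (G C)))⁻¹ ▷ tau C))
    ∙ (chi E ◁ (F⟪hs V G⟨Y⟩⟫ ▷ tau C))
    ∙ (chi E ◁ (pfa F (V (G E)) G⟨Y⟩ ▷ tau C))
    ∙ (chi E ◁ (asc F⟨V (G E)⟩ F⟨G⟨Y⟩⟩ (tau C))⁻¹)
    ∙ (chi E ◁ (F⟨V (G E)⟩ ◁ (pt1 tau Y)⁻¹))
    ∙ (chi E ◁ asc F⟨V (G E)⟩ (tau E) Y)
    ∙ asc (chi E) (F⟨V (G E)⟩ ∘ tau E) Y.

Definition Fhat_ob (V : halfbraid B) : halfbraid Bt := HalfBraid (Fhat_hs V).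

Definition Fhat_map (V W : halfbraid B) (f : forall A : B, V A ⟶ W A)
    (C : Bt) : Fhat_ob V C ⟶ Fhat_ob W C :=
  chi C ◁ (F⟪f (G C)⟫ ▷ tau C).

Definition Fhat_J (V W : halfbraid B) (C : Bt) :
    ten_hb (Fhat_ob V) (Fhat_ob W) C ⟶ Fhat_ob (ten_hb V W) C :=
  (chi C ◁ (pfa F (V (G C)) (W (G C)) ▷ tau C))
    ∙ (chi C ◁ (asc F⟨V (G C)⟩ F⟨W (G C)⟩ (tau C))⁻¹)
    ∙ (chi C ◁ (F⟨V (G C)⟩ ◁ lun (F⟨W (G C)⟩ ∘ tau C)))
    ∙ (chi C ◁ (F⟨V (G C)⟩ ◁ (omega C ▷ (F⟨W (G C)⟩ ∘ tau C))))
    ∙ (chi C ◁ (F⟨V (G C)⟩ ◁ (asc (tau C) (chi C) (F⟨W (G C)⟩ ∘ tau C))⁻¹))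
    ∙ (chi C ◁ asc F⟨V (G C)⟩ (tau C) (chi C ∘ (F⟨W (G C)⟩ ∘ tau C)))
    ∙ asc (chi C) (F⟨V (G C)⟩ ∘ tau C) (chi C ∘ (F⟨W (G C)⟩ ∘ tau C)).

(* The constructions above, once known to land in the center of [Bt]. *)
Definition Fhat
    (h0 : forall V : center_ob B, is_halfbraid (Fhat_ob V))
    (h1 : forall (V W : center_ob B) (f : center_hom V W),
      is_center_hom (Fhat_map f)) :
    functor_data (center B) (center Bt) :=
  @FunctorData k (center B) (center Bt)
    (fun V => CenterOb (h0 V)) (fun V W f => CenterHom (h1 V W f)).

End InducedFunctor.

(* Main.v *)
(** The half-braiding of the induced object is a vertical pasting of squares:
    [chi_Y^-1] on top of [F sigma_(G Y)] on top of [tau_Y^-1].  All 2-cells in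
    sight (coherence cells, [alpha], [omega], components of modifications) are
    morphisms between such squares, and morphisms of squares are closed under
    composition and pasting; so a family of 2-cells is a morphism of the center
    as soon as it is built from these.  The remaining axioms of a monoidal
    functor can then be checked one 0-cell at a time; for the unit, [omega] is
    completed to an adjoint equivalence between [tau] and [chi].

    Exchanging the roles of [F] and [G] gives the same construction [Ghat] in
    the other direction, and it suffices to find a natural isomorphism from
    [Fhat (Ghat W)] to [W]: the other one is the same statement with [F] and [G]
    exchanged.  With [P := chi (F tau') tau], where [tau'] is the equivalence
    from the identity to [G F], it slides [F G W] past [tau], then [W] past [P]
    by the half-braiding of [W], and cancels the equivalences left around [W]. *)
Require Import Defs.
From mathcomp Require Import all_boot all_order all_algebra.
From mathcomp Require Import boolp.

Set Implicit Arguments.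
Unset Strict Implicit.
Unset Printing Implicit Defensive.

(** * Squares of 2-cells and their two pastings *)

Section Squares.
Variables (k : fieldType) (B : bicat k).

Lemma whisklK (A C D : B) (X X' : B C D) (Y : B A C) (f : X ⟶ X')
  (g : X' ⟶ X) : g ∙ f = idm X -> (g ▷ Y) ∙ (f ▷ Y) = idm (X ∘ Y).
Proof. by move=> e; rewrite -hcompMl e hcomp1. Qed.

Lemma whiskrK (A C D : B) (X : B C D) (Y Y' : B A C) (f : Y ⟶ Y')
  (g : Y' ⟶ Y) : g ∙ f = idm Y -> (X ◁ g) ∙ (X ◁ f) = idm (X ∘ Y).
Proof. by move=> e; rewrite -hcompMr e hcomp1. Qed.

Lemma re2_id (C : lincat k) (X Y Z : C) (f : Z ⟶ Y) (g : Y ⟶ Z)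
  (t : X ⟶ Y) : f ∙ g = idm Y -> f ∙ g ∙ t = t.
Proof. by move=> e; rewrite -cmpA e cmp1m. Qed.

(* With [x0], [x1] identities this is the condition on a morphism of the center;
   with [mA], [mC] identities it is naturality of a half-braiding. *)
Definition sqmor (A0 C0 A1 C1 : B) (X0 X0' : B A0 C0) (X1 X1' : B A1 C1)
  (tA tA' : B A0 A1) (tC tC' : B C0 C1)
  (p : tC ∘ X0 ⟶ X1 ∘ tA) (p' : tC' ∘ X0' ⟶ X1' ∘ tA')
  (mA : tA ⟶ tA') (mC : tC ⟶ tC') (x0 : X0 ⟶ X0') (x1 : X1 ⟶ X1') : Prop :=
  (x1 ⊚ mA) ∙ p = p' ∙ (mC ⊚ x0).

Definition vmor (A0 C0 A1 C1 : B) (X0 : B A0 C0) (X1 : B A1 C1)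
  (tA tA' : B A0 A1) (tC tC' : B C0 C1)
  (p : tC ∘ X0 ⟶ X1 ∘ tA) (p' : tC' ∘ X0 ⟶ X1 ∘ tA')
  (mA : tA ⟶ tA') (mC : tC ⟶ tC') : Prop :=
  sqmor p p' mA mC (idm X0) (idm X1).

(* [vc] has the shape of the half-braiding of a tensor product, [hp] that of a
   half-braiding at a composite 1-cell. *)
Definition vc (A0 C0 A1 C1 A2 C2 : B) (X0 : B A0 C0) (X1 : B A1 C1)
    (X2 : B A2 C2) (sA : B A0 A1) (sC : B C0 C1) (tA : B A1 A2) (tC : B C1 C2)
    (q : tC ∘ X1 ⟶ X2 ∘ tA) (p : sC ∘ X0 ⟶ X1 ∘ sA) :
    (tC ∘ sC) ∘ X0 ⟶ X2 ∘ (tA ∘ sA) :=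
  asc X2 tA sA ∙ (q ▷ sA) ∙ (asc tC X1 sA)⁻¹ ∙ (tC ◁ p) ∙ asc tC sC X0.

Definition hp (A0 C0 D0 A1 C1 D1 : B) (X0 : B C0 D0) (Y0 : B A0 C0)
    (X1 : B C1 D1) (Y1 : B A1 C1) (tA : B A0 A1) (tC : B C0 C1) (tD : B D0 D1)
    (p : tD ∘ X0 ⟶ X1 ∘ tC) (q : tC ∘ Y0 ⟶ Y1 ∘ tA) :
    tD ∘ (X0 ∘ Y0) ⟶ (X1 ∘ Y1) ∘ tA :=
  (asc X1 Y1 tA)⁻¹ ∙ (X1 ◁ q) ∙ asc X1 tC Y0 ∙ (p ▷ Y0) ∙ (asc tD X0 Y0)⁻¹.

(** [usq] is the half-braiding of the unit object, and [hsq] is the value that [hs_unit] prescribes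
    at an identity 1-cell. *)
Definition usq (A C : B) (X : B A C) : id1 C ∘ X ⟶ X ∘ id1 A :=
  (run X)⁻¹ ∙ lun X.

Definition hsq (A C : B) (t : B A C) : t ∘ id1 A ⟶ id1 C ∘ t :=
  (lun t)⁻¹ ∙ run t.

(** Both sides are convertible. The right one is the body of [is_center_hom], so [apply/vmorP] turns
    the condition on a morphism of the center into one about squares. *)
Lemma vmorP (A0 C0 A1 C1 : B) (X0 : B A0 C0) (X1 : B A1 C1)
  (tA tA' : B A0 A1) (tC tC' : B C0 C1)
  (p : tC ∘ X0 ⟶ X1 ∘ tA) (p' : tC' ∘ X0 ⟶ X1 ∘ tA')
  (mA : tA ⟶ tA') (mC : tC ⟶ tC') :
  vmor p p' mA mC <-> (X1 ◁ mA) ∙ p = p' ∙ (mC ▷ X0).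
Proof. by []. Qed.

Lemma sqmor_cmp (A0 C0 A1 C1 : B) (X0 X0' X0'' : B A0 C0)
  (X1 X1' X1'' : B A1 C1) (tA tA' tA'' : B A0 A1) (tC tC' tC'' : B C0 C1)
  (p : tC ∘ X0 ⟶ X1 ∘ tA) (p' : tC' ∘ X0' ⟶ X1' ∘ tA')
  (p'' : tC'' ∘ X0'' ⟶ X1'' ∘ tA'') mA mC x0 x1 nA nC y0 y1 :
  sqmor p' p'' nA nC y0 y1 -> sqmor p p' mA mC x0 x1 ->
  sqmor p p'' (nA ∙ mA) (nC ∙ mC) (y0 ∙ x0) (y1 ∙ x1).
Proof.
by rewrite /sqmor => e e'; rewrite !hcompM cmpA e' -cmpA e cmpA.
Qed.

Lemma vmor_cmp (A0 C0 A1 C1 : B) (X0 : B A0 C0)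
  (X1 : B A1 C1) (tA tA' tA'' : B A0 A1) (tC tC' tC'' : B C0 C1)
  (p : tC ∘ X0 ⟶ X1 ∘ tA) (p' : tC' ∘ X0 ⟶ X1 ∘ tA')
  (p'' : tC'' ∘ X0 ⟶ X1 ∘ tA'') mA mC nA nC :
  vmor p' p'' nA nC -> vmor p p' mA mC -> vmor p p'' (nA ∙ mA) (nC ∙ mC).
Proof.
move=> e e'; rewrite /vmor -(cmp1m (idm X0)) -(cmp1m (idm X1)).
exact: sqmor_cmp e e'.
Qed.

Lemma vmor_id (A0 C0 A1 C1 : B) (X0 : B A0 C0) (X1 : B A1 C1)
  (tA : B A0 A1) (tC : B C0 C1) (p : tC ∘ X0 ⟶ X1 ∘ tA) :
  vmor p p (idm tA) (idm tC).
Proof. by rewrite /vmor /sqmor !hcomp1 cmp1m cmpm1. Qed.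

Lemma sqmor_inv (A0 C0 A1 C1 : B) (X0 X0' : B A0 C0) (X1 X1' : B A1 C1)
  (tA tA' : B A0 A1) (tC tC' : B C0 C1)
  (p : tC ∘ X0 ⟶ X1 ∘ tA) (p' : tC' ∘ X0' ⟶ X1' ∘ tA')
  (mA : iso tA tA') (mC : iso tC tC') (x0 : iso X0 X0') (x1 : iso X1 X1') :
  sqmor p p' mA mC x0 x1 -> sqmor p' p (mA⁻¹) (mC⁻¹) (x0⁻¹) (x1⁻¹).
Proof.
rewrite /sqmor => e; apply: (iso_injl (i := hcomp_iso x1 mA)) => /=.
rewrite -!cmpA e -hcompM !fwdK hcomp1 cmp1m cmpA -hcompM !fwdK hcomp1.
by rewrite cmpm1.
Qed.

Lemma vmor_inv (A0 C0 A1 C1 : B) (X0 : B A0 C0) (X1 : B A1 C1)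
  (tA tA' : B A0 A1) (tC tC' : B C0 C1)
  (p : tC ∘ X0 ⟶ X1 ∘ tA) (p' : tC' ∘ X0 ⟶ X1 ∘ tA')
  (mA : iso tA tA') (mC : iso tC tC') :
  vmor p p' mA mC -> vmor p' p (mA⁻¹) (mC⁻¹).
Proof. exact: (sqmor_inv (x0 := id_iso X0) (x1 := id_iso X1)). Qed.

(** Naturality of the associators carries the 2-cells through the pasting, and each square is used
    once; the cell [x1] on the common edge links the two. *)
Lemma vc_mor (A0 C0 A1 C1 A2 C2 : B) (X0 Y0 : B A0 C0) (X1 Y1 : B A1 C1)
    (X2 Y2 : B A2 C2) (sA sA' : B A0 A1) (sC sC' : B C0 C1)
    (tA tA' : B A1 A2) (tC tC' : B C1 C2)
    (q : tC ∘ X1 ⟶ X2 ∘ tA) (p : sC ∘ X0 ⟶ X1 ∘ sA)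
    (q' : tC' ∘ Y1 ⟶ Y2 ∘ tA') (p' : sC' ∘ Y0 ⟶ Y1 ∘ sA')
    mA mC nA nC x0 x1 x2 :
  sqmor q q' nA nC x1 x2 -> sqmor p p' mA mC x0 x1 ->
  sqmor (vc q p) (vc q' p') (nA ⊚ mA) (nC ⊚ mC) x0 x2.
Proof.
rewrite /sqmor /vc => e e'.
have E1 : ((x2 ⊚ nA) ⊚ mA) ∙ (q ▷ sA) = (q' ▷ sA') ∙ ((nC ⊚ x1) ⊚ mA).
  by rewrite -!hcompM e cmp1m cmpm1.
have E2 : (nC ⊚ (x1 ⊚ mA)) ∙ (tC ◁ p) = (tC' ◁ p') ∙ (nC ⊚ (mC ⊚ x0)).
  by rewrite -!hcompM e' cmp1m cmpm1.
rewrite (re2 _ (esym (asc_nat _ _ _))) !cmpA (re2 _ E1) !cmpA.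
by rewrite (re2 _ (ascV_nat _ _ _)) !cmpA (re2 _ E2) !cmpA asc_nat.
Qed.

Lemma vc_vmor (A0 C0 A1 C1 A2 C2 : B) (X0 : B A0 C0) (X1 : B A1 C1)
    (X2 : B A2 C2) (sA sA' : B A0 A1) (sC sC' : B C0 C1)
    (tA tA' : B A1 A2) (tC tC' : B C1 C2)
    (q : tC ∘ X1 ⟶ X2 ∘ tA) (p : sC ∘ X0 ⟶ X1 ∘ sA)
    (q' : tC' ∘ X1 ⟶ X2 ∘ tA') (p' : sC' ∘ X0 ⟶ X1 ∘ sA') mA mC nA nC :
  vmor q q' nA nC -> vmor p p' mA mC ->
  vmor (vc q p) (vc q' p') (nA ⊚ mA) (nC ⊚ mC).
Proof. exact: vc_mor. Qed.

(** The inverse pastings, kept as isomorphisms so that [iso_bwd] can pass from an equation between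
    inverses to one between the pastings themselves. *)
Definition vc_inv (A0 C0 A1 C1 A2 C2 : B) (X0 : B A0 C0) (X1 : B A1 C1)
    (X2 : B A2 C2) (sA : B A0 A1) (sC : B C0 C1) (tA : B A1 A2) (tC : B C1 C2)
    (q : iso (tC ∘ X1) (X2 ∘ tA)) (p : iso (sC ∘ X0) (X1 ∘ sA)) :
    iso (X2 ∘ (tA ∘ sA)) ((tC ∘ sC) ∘ X0) :=
  comp_iso (inv_iso (asc tC sC X0))
  (comp_iso (hcomp_iso (id_iso tC) (inv_iso p))
  (comp_iso (asc tC X1 sA) (comp_iso (hcomp_iso (inv_iso q) (id_iso sA))
  (inv_iso (asc X2 tA sA))))).

Definition hp_inv (A0 C0 D0 A1 C1 D1 : B) (X0 : B C0 D0) (Y0 : B A0 C0)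
    (X1 : B C1 D1) (Y1 : B A1 C1) (tA : B A0 A1) (tC : B C0 C1) (tD : B D0 D1)
    (p : iso (tD ∘ X0) (X1 ∘ tC)) (q : iso (tC ∘ Y0) (Y1 ∘ tA)) :
    iso ((X1 ∘ Y1) ∘ tA) (tD ∘ (X0 ∘ Y0)) :=
  comp_iso (asc tD X0 Y0) (comp_iso (hcomp_iso (inv_iso p) (id_iso Y0))
  (comp_iso (inv_iso (asc X1 tC Y0)) (comp_iso (hcomp_iso (id_iso X1)
  (inv_iso q)) (asc X1 Y1 tA)))).

(** The interchange law for the two pastings. [trans_comp] is this law for squares pointing the
    other way, so it is applied to the inverse squares and the inverses of both sides are
    compared. *)
Lemma vc_hp (a0 a1 a2 c0 c1 c2 d0 d1 d2 : B)
    (FX : B c0 d0) (FY : B a0 c0) (GX : B c1 d1) (GY : B a1 c1)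
    (HX : B c2 d2) (HY : B a2 c2)
    (sA : B a0 a1) (sC : B c0 c1) (sD : B d0 d1)
    (tA : B a1 a2) (tC : B c1 c2) (tD : B d1 d2)
    (sX : sD ∘ FX ⟶ GX ∘ sC) (sY : sC ∘ FY ⟶ GY ∘ sA)
    (tX : tD ∘ GX ⟶ HX ∘ tC) (tY : tC ∘ GY ⟶ HY ∘ tA) :
  is_iso sX -> is_iso sY -> is_iso tX -> is_iso tY ->
  vc (hp tX tY) (hp sX sY) = hp (vc tX sX) (vc tY sY).
Proof.
move=> [sX' [vX1 vX2]] [sY' [vY1 vY2]] [tX' [wX1 wX2]] [tY' [wY1 wY2]].
pose iX := Iso vX1 vX2; pose iY := Iso vY1 vY2.
pose jX := Iso wX1 wX2; pose jY := Iso wY1 wY2.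
have e : fwd (vc_inv (inv_iso (hp_inv jX jY)) (inv_iso (hp_inv iX iY))) =
         fwd (hp_inv (inv_iso (vc_inv jX iX)) (inv_iso (vc_inv jY iY))).
  exact: trans_comp.
by have := iso_bwd e; rewrite /vc /hp /= !cmpA.
Qed.

Lemma vc_iso (A0 C0 A1 C1 A2 C2 : B) (X0 : B A0 C0) (X1 : B A1 C1)
    (X2 : B A2 C2) (sA : B A0 A1) (sC : B C0 C1) (tA : B A1 A2) (tC : B C1 C2)
    (q : tC ∘ X1 ⟶ X2 ∘ tA) (p : sC ∘ X0 ⟶ X1 ∘ sA) :
  is_iso q -> is_iso p -> is_iso (vc q p).
Proof.
move=> hq hp; rewrite /vc.
have a1 := is_isoP (asc X2 tA sA).
have a2 := is_isoP (inv_iso (asc tC X1 sA)).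
have a3 := is_isoP (asc tC sC X0).
have b1 : is_iso (q ▷ sA).
  by apply: is_iso_hcomp => //; exact: (is_isoP (id_iso _)).
have b2 : is_iso (tC ◁ p).
  by apply: is_iso_hcomp => //; exact: (is_isoP (id_iso _)).
by repeat apply: is_iso_comp.
Qed.

Lemma vc_hsq (A C D : B) (t : B C D) (s : B A C) :
  vc (hsq t) (hsq s) = hsq (t ∘ s).
Proof.
pose i := comp_iso (inv_iso (asc t s (id1 A)))
  (comp_iso (hcomp_iso (id_iso t) (comp_iso (inv_iso (run s)) (lun s)))
  (comp_iso (asc t (id1 C) s)
  (comp_iso (hcomp_iso (comp_iso (inv_iso (run t)) (lun t)) (id_iso s))
     (inv_iso (asc (id1 D) t s))))).
pose j := comp_iso (inv_iso (run (t ∘ s))) (lun (t ∘ s)).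
have e : fwd i = fwd j by exact: trans_unit.
by have := iso_bwd e; rewrite /vc /hsq /= !cmpA.
Qed.

(** The computation behind [center_ascP], with four possibly different 1-cells [X0] to [X3] in place
    of a single one. *)
Lemma vc_asc (A0 C0 A1 C1 A2 C2 A3 C3 : B) (X0 : B A0 C0) (X1 : B A1 C1)
    (X2 : B A2 C2) (X3 : B A3 C3) (rA : B A0 A1) (rC : B C0 C1)
    (sA : B A1 A2) (sC : B C1 C2) (tA : B A2 A3) (tC : B C2 C3)
    (r : tC ∘ X2 ⟶ X3 ∘ tA) (q : sC ∘ X1 ⟶ X2 ∘ sA)
    (p : rC ∘ X0 ⟶ X1 ∘ rA) :
  vmor (vc (vc r q) p) (vc r (vc q p)) (asc tA sA rA) (asc tC sC rC).
Proof.
rewrite /vmor /sqmor /vc.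
rewrite !hcompMl !hcompMr !cmpA (re3 _ (esym (pentagon _ _ _ _))) !cmpA.
rewrite (re2 _ (asc_nat _ _ _)) hcomp1 !cmpA; do 2 congr (_ ∙ _).
rewrite (re2 _ (asc_whiskV _ _ _ _)) !cmpA; do 2 congr (_ ∙ _).
rewrite (re2 _ (asc_nat _ _ _)) !cmpA; congr (_ ∙ _).
rewrite (re2 _ (pentagonV _ _ _ _)) !cmpA compVKl; congr (_ ∙ _).
by rewrite -(hcomp1 tC sC) (re2 _ (asc_nat _ _ _)) !cmpA pentagon.
Qed.

Lemma vc_lun (A0 C0 A1 C1 : B) (X0 : B A0 C0) (X1 : B A1 C1)
    (tA : B A0 A1) (tC : B C0 C1) (p : tC ∘ X0 ⟶ X1 ∘ tA) :
  vmor (vc (usq X1) p) p (lun tA) (lun tC).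
Proof.
rewrite /vmor /sqmor /vc /usq.
have K : (run X1 ▷ tA) ∙ ((run X1)⁻¹ ▷ tA) = idm _.
  by rewrite -hcompMl fwdK hcomp1.
rewrite (re2 _ (triangle _ _)) hcompMl !cmpA (re2 _ K) cmp1m -lun_comp !cmpA.
by rewrite compVKl (re2 _ (lun_nat _)) !cmpA lun_comp.
Qed.

Lemma vc_run (A0 C0 A1 C1 : B) (X0 : B A0 C0) (X1 : B A1 C1)
    (tA : B A0 A1) (tC : B C0 C1) (p : tC ∘ X0 ⟶ X1 ∘ tA) :
  vmor (vc p (usq X0)) p (run tA) (run tC).
Proof.
rewrite /vmor /sqmor /vc /usq.
have K : (tC ◁ run X0) ∙ (tC ◁ (run X0)⁻¹) = idm _.
  by rewrite -hcompMr fwdK hcomp1.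
rewrite (re2 _ (run_comp _ _)) (re2 _ (run_nat _)) -run_comp !cmpA compVKl.
by rewrite hcompMr !cmpA (re2 _ K) cmp1m triangle.
Qed.

End Squares.

(** * Images of squares under a pseudofunctor *)

Section PseudofunctorSquares.
Variables (k : fieldType) (B Bt : bicat k) (F : pseudofun B Bt).

Lemma pfM (A C : B) (X Y Z : B A C) (f : Y ⟶ Z) (g : X ⟶ Y) :
  F⟪f ∙ g⟫ = F⟪f⟫ ∙ F⟪g⟫.
Proof. exact: fmapM (lf_law (pf1 F A C)) _ _ _ _ _. Qed.

Lemma pfI (A C : B) (X : B A C) : F⟪idm X⟫ = idm F⟨X⟩.
Proof. exact: fmap1 (lf_law (pf1 F A C)) _. Qed.

Lemma pfVK (A C : B) (X Y : B A C) (i : iso X Y) : F⟪i⟫ ∙ F⟪i⁻¹⟫ = idm F⟨Y⟩.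
Proof. by rewrite -pfM fwdK pfI. Qed.

Lemma pfa_natl (A C D : B) (X : B C D) (Y Y' : B A C) (g : Y ⟶ Y') :
  pfa F X Y' ∙ (F⟨X⟩ ◁ F⟪g⟫) = F⟪X ◁ g⟫ ∙ pfa F X Y.
Proof. by rewrite -pfI pfa_nat. Qed.

Lemma pfa_natr (A C D : B) (X X' : B C D) (Y : B A C) (f : X ⟶ X') :
  pfa F X' Y ∙ (F⟪f⟫ ▷ F⟨Y⟩) = F⟪f ▷ Y⟫ ∙ pfa F X Y.
Proof. by rewrite -pfI pfa_nat. Qed.

Lemma pfa_ascV (A C D E : B) (X : B D E) (Y : B C D) (Z : B A C) :
  pfa F (X ∘ Y) Z ∙ (pfa F X Y ▷ F⟨Z⟩) ∙ (asc F⟨X⟩ F⟨Y⟩ F⟨Z⟩)⁻¹ =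
  F⟪(asc X Y Z)⁻¹⟫ ∙ pfa F X (Y ∘ Z) ∙ (F⟨X⟩ ◁ pfa F Y Z).
Proof.
apply: (iso_injl (i := fmap_iso F (asc X Y Z))) => /=.
rewrite -[RHS]cmpA pfVK cmp1m.
apply: (iso_injr (i := asc F⟨X⟩ F⟨Y⟩ F⟨Z⟩)).
by rewrite !cmpA bwdK cmpm1 pfa_asc.
Qed.

Definition Fsq (A0 C0 A1 C1 : B) (X0 : B A0 C0) (X1 : B A1 C1)
    (tA : B A0 A1) (tC : B C0 C1) (p : tC ∘ X0 ⟶ X1 ∘ tA) :
    F⟨tC⟩ ∘ F⟨X0⟩ ⟶ F⟨X1⟩ ∘ F⟨tA⟩ :=
  (pfa F X1 tA)⁻¹ ∙ F⟪p⟫ ∙ pfa F tC X0.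

Lemma Fsq_iso (A0 C0 A1 C1 : B) (X0 : B A0 C0) (X1 : B A1 C1)
    (tA : B A0 A1) (tC : B C0 C1) (p : tC ∘ X0 ⟶ X1 ∘ tA) :
  is_iso p -> is_iso (Fsq p).
Proof.
move=> [q [qp pq]].
apply: is_iso_comp (is_isoP (inv_iso (pfa F X1 tA))) _.
apply: is_iso_comp (is_isoP (fmap_iso F (Iso qp pq))) _.
exact: is_isoP (pfa F tC X0).
Qed.

Lemma Fsq_mor (A0 C0 A1 C1 : B) (X0 X0' : B A0 C0) (X1 X1' : B A1 C1)
  (tA tA' : B A0 A1) (tC tC' : B C0 C1)
  (p : tC ∘ X0 ⟶ X1 ∘ tA) (p' : tC' ∘ X0' ⟶ X1' ∘ tA') mA mC x0 x1 :
  sqmor p p' mA mC x0 x1 ->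
  sqmor (Fsq p) (Fsq p') F⟪mA⟫ F⟪mC⟫ F⟪x0⟫ F⟪x1⟫.
Proof.
rewrite /sqmor /Fsq => e.
apply: (iso_injl (i := pfa F X1' tA')).
rewrite -[LHS]cmpA pfa_nat !cmpA !compVKl (re2 _ (esym (pfM _ _))) e.
by rewrite pfM !cmpA pfa_nat.
Qed.

Lemma Fsq_vmor (A0 C0 A1 C1 : B) (X0 : B A0 C0) (X1 : B A1 C1)
  (tA tA' : B A0 A1) (tC tC' : B C0 C1)
  (p : tC ∘ X0 ⟶ X1 ∘ tA) (p' : tC' ∘ X0 ⟶ X1 ∘ tA') mA mC :
  vmor p p' mA mC -> vmor (Fsq p) (Fsq p') F⟪mA⟫ F⟪mC⟫.
Proof. by move=> e; rewrite /vmor -!pfI; apply: Fsq_mor. Qed.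

(** Each of the three associators in [vc] is carried across by the associativity axiom of [F]; the
    [pfa] cells in between cancel or move by naturality. *)
Lemma Fsq_vc (A0 C0 A1 C1 A2 C2 : B) (X0 : B A0 C0) (X1 : B A1 C1)
    (X2 : B A2 C2) (sA : B A0 A1) (sC : B C0 C1) (tA : B A1 A2) (tC : B C1 C2)
    (q : tC ∘ X1 ⟶ X2 ∘ tA) (p : sC ∘ X0 ⟶ X1 ∘ sA) :
  vmor (vc (Fsq q) (Fsq p)) (Fsq (vc q p)) (pfa F tA sA) (pfa F tC sC).
Proof.
rewrite /vmor /sqmor /vc /Fsq.
apply: (iso_injl (i := pfa F X2 (tA ∘ sA))).
rewrite !cmpA compVKl !pfM !hcompMl !hcompMr !cmpA.
rewrite (re3 _ (esym (pfa_asc _ _ _ _))) !cmpA (re2_id _ (whisklK _ (fwdK _))).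
rewrite (re2 _ (pfa_natr _ _)) !cmpA (re3 _ (pfa_ascV _ _ _)) !cmpA.
rewrite (re2_id _ (whiskrK _ (fwdK _))) (re2 _ (pfa_natl _ _)) !cmpA.
by rewrite -pfa_asc.
Qed.

Lemma Fsq_hp (A0 C0 D0 A1 C1 D1 : B) (X0 : B C0 D0) (Y0 : B A0 C0)
    (X1 : B C1 D1) (Y1 : B A1 C1) (tA : B A0 A1) (tC : B C0 C1) (tD : B D0 D1)
    (p : tD ∘ X0 ⟶ X1 ∘ tC) (q : tC ∘ Y0 ⟶ Y1 ∘ tA) :
  sqmor (hp (Fsq p) (Fsq q)) (Fsq (hp p q)) (idm _) (idm _)
    (pfa F X0 Y0) (pfa F X1 Y1).
Proof.
rewrite /sqmor /hp /Fsq.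
apply: (iso_injl (i := pfa F (X1 ∘ Y1) tA)).
rewrite !cmpA compVKl !pfM !hcompMl !hcompMr !cmpA.
rewrite (re3 _ (pfa_ascV _ _ _)) !cmpA (re2_id _ (whiskrK _ (fwdK _))).
rewrite (re2 _ (pfa_natl _ _)) !cmpA (re3 _ (esym (pfa_asc _ _ _ _))) !cmpA.
rewrite (re2_id _ (whisklK _ (fwdK _))) (re2 _ (pfa_natr _ _)) !cmpA.
by rewrite pfa_ascV.
Qed.

Lemma Fsq_usq (A C : B) (X : B A C) :
  vmor (usq F⟨X⟩) (Fsq (usq X)) (pfu F A) (pfu F C).
Proof.
rewrite /vmor /sqmor /usq /Fsq pfM !cmpA pfu_lun.
apply: (iso_injl (i := pfa F X (id1 A))); rewrite compVKl.
apply: (iso_injl (i := fmap_iso F (run X))) => /=.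
by rewrite (re2_id _ (pfVK _)) (re3 _ (pfu_run _ _)) compVKl.
Qed.

Lemma Fsq_hsq (A C : B) (t : B A C) :
  sqmor (hsq F⟨t⟩) (Fsq (hsq t)) (idm _) (idm _) (pfu F A) (pfu F C).
Proof.
rewrite /vmor /sqmor /hsq /Fsq pfM !cmpA pfu_run.
apply: (iso_injl (i := pfa F (id1 C) t)); rewrite compVKl.
apply: (iso_injl (i := fmap_iso F (lun t))) => /=.
by rewrite (re2_id _ (pfVK _)) (re3 _ (pfu_lun _ _)) compVKl.
Qed.

End PseudofunctorSquares.

(** * Transformations and modifications as squares *)

Section TransformationSquares.
Variables (k : fieldType) (B Bt : bicat k) (P Q : pseudofun B Bt).

(** Components of a transformation point from [Q⟨X⟩ ∘ t A] to [t C ∘ P⟨X⟩], against the direction of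
    squares; hence the axioms are restated for their inverses, here and in the next lemmas. *)
Lemma ptV_nat (t : pntrans P Q) (A C : B) (X Y : B A C) (f : X ⟶ Y) :
  sqmor (pt1 t X)⁻¹ (pt1 t Y)⁻¹ (idm _) (idm _) P⟪f⟫ Q⟪f⟫.
Proof.
rewrite /sqmor; apply: (iso_injl (i := pt1 t Y)).
by rewrite compVKl -cmpA pt_nat cmpA fwdK cmpm1.
Qed.

Lemma ptV_comp (t : pntrans P Q) (A C D : B) (X : B C D) (Y : B A C) :
  sqmor (hp (pt1 t X)⁻¹ (pt1 t Y)⁻¹) (pt1 t (X ∘ Y))⁻¹ (idm _) (idm _)
    (pfa P X Y) (pfa Q X Y).
Proof.
rewrite /sqmor /hp; apply: (iso_injl (i := pt1 t (X ∘ Y))).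
rewrite compVKl -cmpA pt_comp !cmpA compVKl.
rewrite (re2_id _ (whiskrK _ (fwdK _))) compKl.
by rewrite (re2_id _ (whisklK _ (fwdK _))) fwdK cmpm1.
Qed.

Lemma ptV_unit (t : pntrans P Q) (A : B) :
  sqmor (hsq (t A)) (pt1 t (id1 A))⁻¹ (idm _) (idm _) (pfu P A) (pfu Q A).
Proof.
rewrite /sqmor /hsq; apply: (iso_injl (i := pt1 t (id1 A))).
by rewrite compVKl -cmpA pt_unit !cmpA compVKl bwdK cmpm1.
Qed.

Lemma mdV_nat (s t : pntrans P Q) (m : modification s t) (A C : B) (X : B A C) :
  vmor (pt1 s X)⁻¹ (pt1 t X)⁻¹ (m A) (m C).
Proof.
rewrite /vmor /sqmor; apply: (iso_injl (i := pt1 t X)).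
by rewrite compVKl -cmpA -md_nat cmpA fwdK cmpm1.
Qed.

End TransformationSquares.

Lemma comp_ptV (k : fieldType) (B Bt : bicat k) (P Q R : pseudofun B Bt)
    (t : pntrans Q R) (s : pntrans P Q) (A C : B) (X : B A C) :
  (pt1 (comp_pt t s) X)⁻¹ = vc (pt1 t X)⁻¹ (pt1 s X)⁻¹.
Proof. by rewrite /vc /= !cmpA. Qed.

(** * The induced half-braiding and tensor constraint *)

Section InducedHalfBraiding.
Variables (k : fieldType) (B Bt : bicat k) (F : pseudofun B Bt).
Variable D : biequiv_data F.

Local Notation G := (bG D).
Local Notation chi := (bchi D).
Local Notation tau := (btau D).
Local Notation omega := (bomega D).

(** Distributing the whiskerings over the pasting gives the long composite of the definition; from
    here on only the pasting is used. *)
Lemma Fhat_hsE (V : halfbraid B) (C E : Bt) (Y : Bt C E) :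
  Fhat_hs D V Y = vc (pt1 chi Y)⁻¹ (vc (Fsq F (hs V G⟨Y⟩)) (pt1 tau Y)⁻¹).
Proof. by rewrite /Fhat_hs /vc /Fsq !hcompMl !hcompMr !cmpA. Qed.

Lemma FhatP (V : halfbraid B) : is_halfbraid V -> is_halfbraid (Fhat_ob D V).
Proof.
move=> hV.
have isoV (A C : Bt) (Y : Bt A C) : is_iso (Fsq F (hs V G⟨Y⟩)).
  by apply: Fsq_iso; apply: hs_iso.
have isoc (A C : Bt) (Y : Bt A C) := is_isoP (inv_iso (pt1 chi Y)).
have isot (A C : Bt) (Y : Bt A C) := is_isoP (inv_iso (pt1 tau Y)).
split=> [A C X|A C X Y f|A|A C E X Y].
- rewrite [hs _ _]Fhat_hsE.
  exact: vc_iso (isoc _ _ X) (vc_iso (isoV _ _ X) (isot _ _ X)).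
- have e : sqmor (hs V G⟨X⟩) (hs V G⟨Y⟩) (idm _) (idm _) G⟪f⟫ G⟪f⟫.
    exact: esym (hs_nat hV G⟪f⟫).
  have := vc_mor (ptV_nat chi f) (vc_mor (Fsq_mor F e) (ptV_nat tau f)).
  rewrite -!Fhat_hsE /sqmor !pfI !hcomp1 => e2.
  exact: esym e2.
(* Naturality of the half-braiding at [pfu G A] leads from [G⟨id1 A⟩] to [id1 (G A)], where
   [hs_unit] applies; composites are treated likewise with [pfa]. *)
- have e : sqmor (hsq (V (G A))) (hs V G⟨id1 A⟩) (idm _) (idm _)
      (pfu G A) (pfu G A).
    rewrite /sqmor (hs_nat hV (pfu G A)); congr (_ ∙ _).
    by rewrite hs_unit.
  have := sqmor_cmp (Fsq_mor F e) (Fsq_hsq F (V (G A))).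
  rewrite !pfI !cmp1m => e'.
  have := vc_mor (ptV_unit chi A) (vc_mor e' (ptV_unit tau A)).
  rewrite -Fhat_hsE /sqmor !hcomp1 !vc_hsq cmp1m cmpm1 => e2.
  by rewrite -[LHS]/(Fhat_hs D V (id1 A)) -e2.
- have e : sqmor (hp (hs V G⟨X⟩) (hs V G⟨Y⟩)) (hs V G⟨X ∘ Y⟩) (idm _) (idm _)
      (pfa G X Y) (pfa G X Y).
    rewrite /sqmor (hs_nat hV (pfa G X Y)); congr (_ ∙ _).
    by rewrite hs_comp.
  have := sqmor_cmp (Fsq_mor F e) (Fsq_hp F (hs V G⟨X⟩) (hs V G⟨Y⟩)).
  rewrite !pfI !cmp1m => e'.
  have := vc_mor (ptV_comp chi X Y) (vc_mor e' (ptV_comp tau X Y)).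
  rewrite -Fhat_hsE /sqmor !hcomp1 cmp1m cmpm1 => e2.
  rewrite -[LHS]/(Fhat_hs D V (X ∘ Y)) -e2.
  (* The half-braiding pastes three squares, so the interchange law is used twice. *)
  rewrite (vc_hp (isot _ _ X) (isot _ _ Y) (isoV _ _ X) (isoV _ _ Y)).
  rewrite (vc_hp (vc_iso (isoV _ _ X) (isot _ _ X))
    (vc_iso (isoV _ _ Y) (isot _ _ Y)) (isoc _ _ X) (isoc _ _ Y)).
  by rewrite -!Fhat_hsE.
Qed.

Lemma Fhat_mapP (V W : halfbraid B) (f : center_hom V W) :
  is_center_hom (Fhat_map D f).
Proof.
move=> A C X; rewrite [hs _ _]Fhat_hsE [hs _ X]Fhat_hsE; apply/vmorP.
apply: vc_vmor (vmor_id _) _; apply: vc_vmor _ (vmor_id _).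
exact: Fsq_vmor (zmapP f G⟨X⟩).
Qed.

Lemma Fhat_JP (V W : halfbraid B) : is_center_hom (Fhat_J D V W).
Proof.
move=> A C X; apply/vmorP.
pose cX := (pt1 chi X)⁻¹; pose tX := (pt1 tau X)⁻¹.
pose vX := Fsq F (hs V G⟨X⟩); pose wX := Fsq F (hs W G⟨X⟩).
have eL : hs (ten_hb (Fhat_ob D V) (Fhat_ob D W)) X =
    vc (vc cX (vc vX tX)) (vc cX (vc wX tX)) by rewrite -!Fhat_hsE.
have eR : hs (Fhat_ob D (ten_hb V W)) X =
    vc cX (vc (Fsq F (vc (hs V G⟨X⟩) (hs W G⟨X⟩))) tX) by exact: Fhat_hsE.
rewrite eL eR /Fhat_J.
(* The inverse component of the identity transformation is [usq] by computation. *)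
have om : vmor (vc tX cX) (usq F⟨G⟨X⟩⟩) (omega A) (omega C).
  by have := mdV_nat omega X; rewrite comp_ptV.
(* The seven factors of [Fhat_J] are treated in turn, beginning with the one applied last. *)
apply: vmor_cmp.
  apply: vc_vmor (vmor_id cX) _; exact: vc_vmor (Fsq_vc F _ _) (vmor_id tX).
apply: vmor_cmp.
  apply: vc_vmor (vmor_id cX) _; exact: vmor_inv (vc_asc _ _ _).
apply: vmor_cmp.
  apply: vc_vmor (vmor_id cX) _; exact: vc_vmor (vmor_id vX) (vc_lun _).
apply: vmor_cmp.
  apply: vc_vmor (vmor_id cX) _; apply: vc_vmor (vmor_id vX) _.
  exact: vc_vmor om (vmor_id _).
apply: vmor_cmp.
  apply: vc_vmor (vmor_id cX) _; apply: vc_vmor (vmor_id vX) _.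
  exact: vmor_inv (vc_asc _ _ _).
apply: vmor_cmp; first by apply: vc_vmor (vmor_id cX) _; apply: vc_asc.
exact: vc_asc.
Qed.

End InducedHalfBraiding.

(** * Conjugation by an equivalence, at a single 0-cell *)

Section Absorption.
Variables (k : fieldType) (B : bicat k) (a c : B).
Variables (chi : B a c) (tau : B c a) (om : iso (tau ∘ chi) (id1 a)).

(* [locked] here and below: [cmpA] would otherwise match inside the unfolded
   composite isomorphism. *)
Definition absorb (d : B) (z : B d a) : iso (tau ∘ (chi ∘ z)) z :=
  locked (comp_iso (lun z) (comp_iso (hcomp_iso om (id_iso z))
    (inv_iso (asc tau chi z)))).

Lemma absorbE (d : B) (z : B d a) :
  absorb z = lun z ∙ (om ▷ z) ∙ (asc tau chi z)⁻¹ :> (_ ⟶ _).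
Proof. by rewrite /absorb -lock. Qed.

Lemma absorb_nat (d : B) (z z' : B d a) (h : z ⟶ z') :
  absorb z' ∙ (tau ◁ (chi ◁ h)) = h ∙ absorb z.
Proof.
rewrite !absorbE !cmpA -ascV_nat hcomp1 (re2 _ (Defs.interchange _ _)) !cmpA.
by rewrite (re2 _ (lun_nat _)) !cmpA.
Qed.

Lemma absorb_comp (d e : B) (z : B d a) (y : B e d) :
  absorb (z ∘ y) ∙ (tau ◁ asc chi z y) ∙ asc tau (chi ∘ z) y = absorb z ▷ y.
Proof.
rewrite !absorbE !cmpA !hcompMl.
have -> : (asc tau chi (z ∘ y))⁻¹ ∙ (tau ◁ asc chi z y) ∙ asc tau (chi ∘ z) y =
    asc (tau ∘ chi) z y ∙ ((asc tau chi z)⁻¹ ▷ y) by rewrite asc_whiskV.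
rewrite -[in LHS](hcomp1 z y) (re2 _ (esym (asc_nat _ _ _))) !cmpA.
by rewrite (re2 _ (lun_comp _ _)).
Qed.

(** Whiskering with [chi] and then with [tau] is conjugate to the identity by [absorb], so the first
    whiskering is faithful. *)
Lemma whiskl_inj (d : B) (z z' : B d a) (h h' : z ⟶ z') :
  chi ◁ h = chi ◁ h' -> h = h'.
Proof.
move=> e; apply: (iso_injr (i := absorb z)).
by rewrite -!absorb_nat e.
Qed.

(** For [v := F⟨V (G C)⟩] this is [Fhat0], and [conj_mul] is the part of [Fhat_J] applied before
    [pfa]. *)
Definition conj1 (v : B a a) : B c c := chi ∘ (v ∘ tau).

Definition conj_mul (v w : B a a) : conj1 v ∘ conj1 w ⟶ conj1 (v ∘ w) :=
  locked ((chi ◁ ((asc v w tau)⁻¹ ∙ (v ◁ absorb (w ∘ tau))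
                    ∙ asc v tau (conj1 w)))
    ∙ asc chi (v ∘ tau) (conj1 w)).

Lemma conj_mulE (v w : B a a) : conj_mul v w =
  (chi ◁ ((asc v w tau)⁻¹ ∙ (v ◁ absorb (w ∘ tau)) ∙ asc v tau (conj1 w)))
    ∙ asc chi (v ∘ tau) (conj1 w).
Proof. by rewrite /conj_mul -lock. Qed.

Lemma conj_mul_nat (v v' w w' : B a a) (f : v ⟶ v') (g : w ⟶ w') :
  conj_mul v' w' ∙ ((chi ◁ (f ▷ tau)) ⊚ (chi ◁ (g ▷ tau))) =
  (chi ◁ ((f ⊚ g) ▷ tau)) ∙ conj_mul v w.
Proof.
rewrite !conj_mulE !cmpA asc_nat -[RHS]cmpA -[LHS]cmpA -!hcompMr.
congr ((chi ◁ _) ∙ _); rewrite !cmpA asc_nat.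
have E : (v' ◁ absorb (w' ∘ tau)) ∙ (f ⊚ (tau ◁ (chi ◁ (g ▷ tau)))) =
    (f ⊚ (g ▷ tau)) ∙ (v ◁ absorb (w ∘ tau)).
  by rewrite -!hcompM absorb_nat cmp1m cmpm1.
by rewrite (re2 _ E) !cmpA (re2 _ (esym (ascV_nat _ _ _))) !cmpA.
Qed.

Lemma conj_mul_asc (v w u : B a a) :
  (chi ◁ (asc v w u ▷ tau)) ∙ conj_mul (v ∘ w) u ∙ (conj_mul v w ▷ conj1 u) =
  conj_mul v (w ∘ u) ∙ (conj1 v ◁ conj_mul w u)
    ∙ asc (conj1 v) (conj1 w) (conj1 u).
Proof.
pose uh := conj1 u; pose wh := conj1 w.
(* The left side cancels the pair between [w] and [u] before the one in front of [w], the right side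
   after it. *)
have L : absorb (w ∘ u ∘ tau) ∙ (tau ◁ conj_mul w u) ∙ asc tau wh uh =
    (asc w u tau)⁻¹ ∙ (w ◁ absorb (u ∘ tau)) ∙ asc w tau uh
      ∙ (absorb (w ∘ tau) ▷ uh).
  rewrite conj_mulE (hcompMr tau) cmpA (re2 _ (absorb_nat _)) !cmpA.
  by rewrite -(absorb_comp (w ∘ tau) uh).
have tl := pentagon chi (v ∘ tau) wh uh.
rewrite (conj_mulE (v ∘ w)) (conj_mulE v w) (conj_mulE v (w ∘ u)).
rewrite !(hcompMl uh) !cmpA (re2 _ (asc_nat _ _ _)) !cmpA.
rewrite -(hcomp1 chi (v ∘ tau)) (re2 _ (asc_nat _ _ _)) !cmpA tl.
rewrite -!cmpA -!(hcompMr chi); do 2 congr (_ ∙ _); congr (chi ◁ _).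
rewrite !cmpA (re2 _ (pentagonV _ _ _ _)) !cmpA; congr (_ ∙ _).
rewrite -(hcomp1 v w) (re2 _ (asc_nat _ _ _)) !cmpA.
rewrite !(hcompMl uh) (re2 _ (asc_whiskV _ _ _ _)) !cmpA compVKl.
rewrite (re2 _ (asc_nat _ _ _)) !cmpA.
rewrite -(hcomp1 v tau) (re2 _ (asc_nat _ _ _)) !cmpA pentagon.
rewrite -!cmpA -!(hcompMr v); do 2 congr (_ ∙ _); congr (v ◁ _).
by rewrite !cmpA.
Qed.

End Absorption.

(** * The adjoint unit and unitality of conjugation *)

Section AdjointUnit.
Variables (k : fieldType) (B : bicat k) (a c : B).
Variables (chi : B a c) (tau : B c a).
Variables (om : iso (tau ∘ chi) (id1 a)) (th : iso (chi ∘ tau) (id1 c)).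

(* [tau ∘ -] is fully faithful, with quasi-inverse [chi ∘ -]; the unit is the
   2-cell whose image under it is prescribed by one triangle identity,
   [adj_unit_tau], and the other one follows. *)
Definition adj_unit : iso (id1 c) (chi ∘ tau) :=
  locked (comp_iso (absorb th (chi ∘ tau))
    (comp_iso (hcomp_iso (id_iso chi)
                 (comp_iso (inv_iso (absorb om tau)) (run tau)))
      (inv_iso (absorb th (id1 c))))).

Lemma adj_unit_tau : tau ◁ adj_unit = (absorb om tau)⁻¹ ∙ run tau.
Proof.
apply: (whiskl_inj om); apply: (iso_injl (i := absorb th (chi ∘ tau))).
by rewrite absorb_nat /adj_unit -lock /= !cmpA bwdK cmpm1.
Qed.

(** Whiskering with [tau] is faithful because of [th], and it brings [adj_unit] into the position
    where [adj_unit_tau] applies. *)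
Lemma adj_unit_chi (d : B) (z : B d a) :
  (chi ◁ absorb om z) ∙ asc chi tau (chi ∘ z) ∙ (adj_unit ▷ (chi ∘ z)) =
  lun (chi ∘ z).
Proof.
apply: (whiskl_inj th); apply: (iso_injl (i := absorb om z)).
rewrite !(hcompMr tau) (re2 _ (absorb_nat om _)) !cmpA.
have E : absorb om (tau ∘ (chi ∘ z)) ∙ (tau ◁ asc chi tau (chi ∘ z)) =
    (absorb om tau ▷ (chi ∘ z)) ∙ (asc tau (chi ∘ tau) (chi ∘ z))⁻¹.
  by rewrite -absorb_comp !cmpA fwdK cmpm1.
rewrite (re2 _ E) !cmpA -ascV_nat adj_unit_tau hcompMl !cmpA.
rewrite (re2_id _ (whisklK _ (fwdK _))) -triangle !cmpA.
by rewrite fwdK cmpm1.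
Qed.

Definition conj_unit : iso (id1 c) (conj1 chi tau (id1 a)) :=
  comp_iso (hcomp_iso (id_iso chi) (inv_iso (lun tau))) adj_unit.

Lemma conj_unitE : conj_unit = (chi ◁ (lun tau)⁻¹) ∙ adj_unit :> (_ ⟶ _).
Proof. by []. Qed.

(** Left unitality comes from the triangle identity [adj_unit_chi], right unitality below from
    [adj_unit_tau]. *)
Lemma conj_mul_lun (v : B a a) :
  (chi ◁ (lun v ▷ tau)) ∙ conj_mul om (id1 a) v ∙ (conj_unit ▷ conj1 chi tau v)
  = lun (conj1 chi tau v).
Proof.
pose vh := conj1 chi tau v.
have E : (lun v ▷ tau) ∙ (asc (id1 a) v tau)⁻¹
    ∙ (id1 a ◁ absorb om (v ∘ tau)) ∙ asc (id1 a) tau vh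
    ∙ ((lun tau)⁻¹ ▷ vh) = absorb om (v ∘ tau).
  rewrite -lun_comp !cmpA compVKl (re2 _ (lun_nat _)) !cmpA.
  by rewrite (re2 _ (lun_comp _ _)) (whisklK _ (fwdK _)) cmpm1.
rewrite conj_mulE conj_unitE (hcompMl vh) !cmpA.
rewrite (re2 _ (asc_nat _ _ _)) !cmpA.
rewrite -(adj_unit_chi (v ∘ tau)) -[in RHS]E !(hcompMr chi) !cmpA.
by [].
Qed.

Lemma conj_mul_run (v : B a a) :
  (chi ◁ (run v ▷ tau)) ∙ conj_mul om v (id1 a) ∙ (conj1 chi tau v ◁ conj_unit)
  = run (conj1 chi tau v).
Proof.
have E : (run v ▷ tau) ∙ (asc v (id1 a) tau)⁻¹
    ∙ (v ◁ absorb om (id1 a ∘ tau)) ∙ (v ◁ (tau ◁ (chi ◁ (lun tau)⁻¹)))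
    ∙ (v ◁ (tau ◁ adj_unit)) = v ◁ run tau.
  rewrite -triangle !cmpA compVKl -!(hcompMr v); congr (v ◁ _).
  by rewrite (re2 _ (absorb_nat om _)) adj_unit_tau !cmpA !compVKl.
rewrite conj_mulE conj_unitE (hcompMr (conj1 chi tau v)) !cmpA.
rewrite /conj1 -(hcomp1 chi (v ∘ tau)) -(hcomp1 v tau).
rewrite (re2 _ (asc_nat _ _ _)) !cmpA asc_nat -!cmpA -!(hcompMr chi) !cmpA.
rewrite -!(run_comp chi).
rewrite (re2 _ (asc_nat _ _ _)) !cmpA asc_nat.
rewrite -(run_comp v) -[in RHS]E !(hcompMr chi) !cmpA.
by [].
Qed.

End AdjointUnit.

(** Choice turns the mere existence of an inverse into data, as [absorb] and the later constructions
    require. *)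
Lemma is_iso_exists (k : fieldType) (C : lincat k) (X Y : C) (f : X ⟶ Y) :
  is_iso f -> {i : iso X Y | fwd i = f}.
Proof.
by move=> /cid [g [gf fg]]; exists (Iso gf fg).
Qed.

Lemma center_is_iso (k : fieldType) (B : bicat k) (V W : center_ob B)
  (f : center_hom V W) : (forall A, is_iso (f A)) ->
  @is_iso k (center B) V W f.
Proof.
move=> h; pose i A := sval (is_iso_exists (h A)).
have iE A : fwd (i A) = f A by rewrite /i; case: is_iso_exists.
have hi : @is_center_hom k B V W i by move=> A C X; rewrite !iE zmapP.
have -> : f = fwd (center_iso hi) by apply: center_hom_eq => A; rewrite /= iE.
exact: is_isoP.
Qed.

(** * Absorption and adjoint units as morphisms of squares *)

Section AbsorptionSquares.
Variables (k : fieldType) (B : bicat k) (A0 C0 A1 C1 : B).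
Variables (X0 : B A0 C0) (X1 : B A1 C1).
Variables (cA : B A1 A0) (cC : B C1 C0) (tA : B A0 A1) (tC : B C0 C1).
Variables (c : cC ∘ X1 ⟶ X0 ∘ cA) (t : tC ∘ X0 ⟶ X1 ∘ tA).
Variables (omA : iso (tA ∘ cA) (id1 A1)) (omC : iso (tC ∘ cC) (id1 C1)).
Hypothesis om_vmor : vmor (vc t c) (usq X1) omA omC.

Lemma absorb_vmor (E H : B) (Y : B E H) (zA : B E A1) (zC : B H C1)
    (z : zC ∘ Y ⟶ X1 ∘ zA) :
  vmor (vc t (vc c z)) z (absorb omA zA) (absorb omC zC).
Proof.
rewrite !absorbE; apply: vmor_cmp (vc_lun _) _.
apply: vmor_cmp (vc_vmor om_vmor (vmor_id _)) _.
exact: vmor_inv (vc_asc _ _ _).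
Qed.

End AbsorptionSquares.

Section UnitSquares.
Variables (k : fieldType) (B : bicat k) (A0 C0 A1 C1 : B).
Variables (X0 : B A0 C0) (X1 : B A1 C1).
Variables (cA : B A1 A0) (cC : B C1 C0) (tA : B A0 A1) (tC : B C0 C1).
Variables (c : cC ∘ X1 ⟶ X0 ∘ cA) (t : tC ∘ X0 ⟶ X1 ∘ tA).
Variables (omA : iso (tA ∘ cA) (id1 A1)) (omC : iso (tC ∘ cC) (id1 C1)).
Hypothesis om_vmor : vmor (vc t c) (usq X1) omA omC.
Variables (thA : iso (cA ∘ tA) (id1 A0)) (thC : iso (cC ∘ tC) (id1 C0)).
Hypothesis th_vmor : vmor (vc c t) (usq X0) thA thC.

Lemma adj_unit_vmor :
  vmor (usq X0) (vc c t) (adj_unit omA thA) (adj_unit omC thC).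
Proof.
rewrite /adj_unit -!lock.
apply: vmor_cmp (absorb_vmor th_vmor _) _.
apply: vmor_cmp (vmor_inv (absorb_vmor th_vmor _)).
apply: vc_vmor (vmor_id _) _.
apply: vmor_cmp (vc_run _).
exact: vmor_inv (absorb_vmor om_vmor _).
Qed.

Lemma conj_unit_vmor :
  vmor (usq X0) (vc c (vc (usq X1) t)) (conj_unit omA thA) (conj_unit omC thC).
Proof.
apply: vmor_cmp adj_unit_vmor.
by apply: vc_vmor (vmor_id _) _; apply: vmor_inv (vc_lun _).
Qed.

End UnitSquares.

Lemma conj_mul_iso (k : fieldType) (B : bicat k) (a c : B) (chi : B a c)
    (tau : B c a) (om : iso (tau ∘ chi) (id1 a)) (v w : B a a) :
  is_iso (conj_mul om v w).
Proof.
rewrite conj_mulE; exact: (is_isoP (comp_iso (hcomp_iso (id_iso chi)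
  (comp_iso (inv_iso (asc v w tau))
  (comp_iso (hcomp_iso (id_iso v) (absorb om (w ∘ tau)))
            (asc v tau (conj1 chi tau w)))))
  (asc chi (v ∘ tau) (conj1 chi tau w)))).
Qed.

(** * The induced functor is monoidal *)

Section MonoidalFunctor.
Variables (k : fieldType) (B Bt : bicat k) (F : pseudofun B Bt).
Variable D : biequiv_data F.

Local Notation G := (bG D).
Local Notation chi := (bchi D).
Local Notation tau := (btau D).
Local Notation omega := (bomega D).

Lemma Fhat_linfun h0 h1 : is_linfun (@Fhat k B Bt F D h0 h1).
Proof.
split=> [V|U V W f g|V W f g|V W c f]; apply: center_hom_eq => A /=.
- by rewrite /Fhat_map /= pfI !hcomp1.
- by rewrite /Fhat_map /= pfM hcompMl hcompMr.
- by rewrite /Fhat_map /= (fmapD (lf_law (pf1 F _ _))) hcompDl hcompDr.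
- by rewrite /Fhat_map /= (fmapZ (lf_law (pf1 F _ _))) hcompZl hcompZr.
Qed.

Lemma Fhat_monoidal h0 h1
    (h2 : forall V W : center_ob B, is_center_hom (Fhat_J D V W)) :
  @is_monoidal_functor k (center B) (center Bt) (@Fhat k B Bt F D h0 h1)
    (fun V W : center B => CenterHom (h2 V W)).
Proof.
(* [omega] contracts [tau ∘ chi]; the contraction [th] of [chi ∘ tau] is chosen here, for the unit
   constraint. *)
have /= [_ [th thI]] := bchi_tau D.
pose om C := sval (is_iso_exists (bomega_inv D C)).
have omE C : fwd (om C) = omega C by rewrite /om; case: is_iso_exists.
pose et C := sval (is_iso_exists (thI C)).
have etE C : fwd (et C) = th C by rewrite /et; case: is_iso_exists.
have JE (V W : halfbraid B) (C : Bt) : Fhat_J D V W C =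
    (chi C ◁ (pfa F (V (G C)) (W (G C)) ▷ tau C))
      ∙ conj_mul (om C) F⟨V (G C)⟩ F⟨W (G C)⟩.
  by rewrite /Fhat_J conj_mulE absorbE !hcompMr omE !cmpA.
have whI (C : Bt) (x y : Bt (F (G C)) (F (G C))) (f : x ⟶ y) :
    is_iso f -> is_iso (chi C ◁ (f ▷ tau C)).
  move=> fI; apply: is_iso_hcomp (is_isoP (id_iso _)) _.
  exact: is_iso_hcomp fI (is_isoP (id_iso _)).
have omV (A C : Bt) (X : Bt A C) :
    vmor (vc (pt1 tau X)⁻¹ (pt1 chi X)⁻¹) (usq F⟨G⟨X⟩⟩) (om A) (om C).
  by rewrite !omE; have := mdV_nat omega X; rewrite comp_ptV.
have etV (A C : Bt) (X : Bt A C) :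
    vmor (vc (pt1 chi X)⁻¹ (pt1 tau X)⁻¹) (usq X) (et A) (et C).
  by rewrite !etE; have := mdV_nat th X; rewrite comp_ptV.
split.
- exact: Fhat_linfun.
- move=> V W; apply: center_is_iso => C /=.
  rewrite JE; apply: is_iso_comp (conj_mul_iso _ _ _).
  exact: whI (is_isoP (pfa F _ _)).
- move=> V V' W W' f g; apply: center_hom_eq => C /=.
  rewrite !JE /Fhat_map /= cmpA conj_mul_nat -[LHS]cmpA -[RHS]cmpA.
  congr (_ ∙ _).
  rewrite -!hcompMr -!hcompMl; congr (_ ◁ (_ ▷ _)).
  exact: (pfa_nat F (f (G C)) (g (G C))).
- move=> U V W; apply: center_hom_eq => C /=.
  set u := U (G C); set v := V (G C); set w := W (G C).
  (* Naturality moves both [pfa] cells outwards; what remains is associativity of [conj_mul] and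
     that of [F]. *)
  have n1 := conj_mul_nat (om C) (pfa F u v) (idm F⟨w⟩).
  have n2 := conj_mul_nat (om C) (idm F⟨u⟩) (pfa F v w).
  rewrite !hcomp1 in n1 n2.
  rewrite !JE /Fhat_map /= hcompMl hcompMr !cmpA (re2 _ n1) !cmpA.
  rewrite (re2 _ n2) !cmpA -conj_mul_asc -2![LHS]cmpA -2![RHS]cmpA.
  congr (_ ∙ _).
  by rewrite -!hcompMr -!hcompMl !cmpA -(pfa_asc F u v w).
pose ei C : iso (id1 C) (Fhat0 D (unit_hb B) C) :=
  comp_iso
    (hcomp_iso (id_iso (chi C)) (hcomp_iso (pfu F (G C)) (id_iso (tau C))))
    (conj_unit (om C) (et C)).
have eP : @is_center_hom k Bt (unit_hb Bt) (Fhat_ob D (unit_hb B)) ei.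
  move=> A C X; apply/vmorP.
  have -> : hs (Fhat_ob D (unit_hb B)) X =
    vc (pt1 chi X)⁻¹ (vc (Fsq F (usq G⟨X⟩)) (pt1 tau X)⁻¹) by exact: Fhat_hsE.
  apply: vmor_cmp (conj_unit_vmor (omV _ _ X) (etV _ _ X)).
  apply: vc_vmor (vmor_id _) _; apply: vc_vmor (Fsq_usq F _) (vmor_id _).
exists (center_iso (V := center_unit Bt) (W := CenterOb (h0 (center_unit B)))
          eP).
move=> V; split; apply: center_hom_eq => C /=.
- have n := conj_mul_nat (om C) (pfu F (G C)) (idm F⟨V (G C)⟩).
  rewrite !hcomp1 in n.
  rewrite !JE /Fhat_map /= hcompMl !cmpA (re2 _ n) !cmpA.
  rewrite -(conj_mul_lun (om C) (et C)) -2![LHS]cmpA.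
  congr (_ ∙ _).
  by rewrite -!hcompMr -!hcompMl !cmpA (pfu_lun F (V (G C))).
- have n := conj_mul_nat (om C) (idm F⟨V (G C)⟩) (pfu F (G C)).
  rewrite !hcomp1 in n.
  rewrite !JE /Fhat_map /= hcompMr !cmpA (re2 _ n) !cmpA.
  rewrite -(conj_mul_run (om C) (et C)) -2![LHS]cmpA.
  congr (_ ∙ _).
  by rewrite -!hcompMr -!hcompMl !cmpA (pfu_run F (V (G C))).
Qed.

End MonoidalFunctor.

(** * Contracting the round trip on the center *)

Section Contraction.
Variables (k : fieldType) (B : bicat k) (x y z : B).
Variables (c : B z x) (t : B x z) (a : B y z) (b : B z y).
Variables (c1 : B y z) (t1 : B z y).
Variables (om : iso (t1 ∘ c1) (id1 y)) (ab : iso (a ∘ b) (id1 z)).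
Variable th : iso (c ∘ t) (id1 x).

(** In the application [x] is [C], [z] is [F (G C)] and [y] is [F (G z)]; [c] and [t] are [chi1] and
    [tau1] at [x], [c1] and [t1] the same at [z], while [a] and [b] are the images under [F] of
    [chi2] and [tau2]. [M], [w], [W] below stand for [F⟨G⟨w⟩⟩] and for the object of the center at
    [z] and at [x]. *)
Let P := c1 ∘ (b ∘ t).

(** A pair [t1 ∘ c1] is created in front of [b ∘ t], so that [N] can move [M] past [t1], turning it
    into [w]. *)
Definition insert_tau (M : B y y) (w : B z z) (N : iso (M ∘ t1) (t1 ∘ w)) :
    iso ((M ∘ b) ∘ t) (t1 ∘ (w ∘ P)) :=
  comp_iso (asc t1 w P) (comp_iso (hcomp_iso N (id_iso P))
  (comp_iso (inv_iso (asc M t1 P))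
  (comp_iso (hcomp_iso (id_iso M) (inv_iso (absorb om (b ∘ t)))) (asc M b t)))).

Definition slide_P (w : B z z) (W : B x x) (H : iso (w ∘ P) (P ∘ W)) :
    iso (w ∘ P) (c1 ∘ (b ∘ (t ∘ W))) :=
  comp_iso (hcomp_iso (id_iso c1) (asc b t W)) (comp_iso (asc c1 (b ∘ t) W) H).

(** Once [W] stands at the right end, the pairs [t1 ∘ c1], [a ∘ b] and [c ∘ t] become adjacent one
    after the other and are absorbed in this order. *)
Definition contract (M : B y y) (w : B z z) (W : B x x)
    (N : iso (M ∘ t1) (t1 ∘ w)) (H : iso (w ∘ P) (P ∘ W)) :
    iso (conj1 c t (a ∘ (M ∘ b))) W :=
  comp_iso (absorb th W) (hcomp_iso (id_iso c)
  (comp_iso (absorb ab (t ∘ W))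
  (comp_iso (hcomp_iso (id_iso a)
    (comp_iso (absorb om (b ∘ (t ∘ W)))
    (comp_iso (hcomp_iso (id_iso t1) (slide_P H)) (insert_tau N))))
  (asc a (M ∘ b) t)))).

Lemma insert_tau_nat (M M' : B y y) (w w' : B z z)
  (N : iso (M ∘ t1) (t1 ∘ w)) (N' : iso (M' ∘ t1) (t1 ∘ w'))
  (fM : M ⟶ M') (fw : w ⟶ w') :
  N' ∙ (fM ▷ t1) = (t1 ◁ fw) ∙ N ->
  insert_tau N' ∙ ((fM ▷ b) ▷ t) = (t1 ◁ (fw ▷ P)) ∙ insert_tau N.
Proof.
move=> e; have e' : (N' ▷ P) ∙ ((fM ▷ t1) ▷ P) = ((t1 ◁ fw) ▷ P) ∙ (N ▷ P).
  by rewrite -!hcompMl e.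
rewrite /= !cmpA asc_nat hcomp1 (re2 _ (esym (Defs.interchange _ _))) !cmpA.
rewrite -(hcomp1 t1 P) (re2 _ (esym (ascV_nat _ _ _))) !cmpA.
by rewrite (re2 _ e') !cmpA (re2 _ (asc_nat _ _ _)) !cmpA.
Qed.

Lemma slide_P_nat (w w' : B z z) (W W' : B x x) (H : iso (w ∘ P) (P ∘ W))
  (H' : iso (w' ∘ P) (P ∘ W')) (fw : w ⟶ w') (fW : W ⟶ W') :
  H' ∙ (fw ▷ P) = (P ◁ fW) ∙ H ->
  slide_P H' ∙ (fw ▷ P) = (c1 ◁ (b ◁ (t ◁ fW))) ∙ slide_P H.
Proof.
move=> e; rewrite /= !cmpA e /P -(hcomp1 c1 (b ∘ t)).
rewrite (re2 _ (asc_nat _ _ _)) !cmpA -(hcomp1 b t).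
have E : (c1 ◁ asc b t W') ∙ (c1 ◁ ((idm b ⊚ idm t) ⊚ fW)) =
   (c1 ◁ (b ◁ (t ◁ fW))) ∙ (c1 ◁ asc b t W) by rewrite -!hcompMr asc_nat.
by rewrite (re2 _ E) !cmpA.
Qed.

Lemma contract_nat (M M' : B y y) (w w' : B z z) (W W' : B x x)
  (N : iso (M ∘ t1) (t1 ∘ w)) (N' : iso (M' ∘ t1) (t1 ∘ w'))
  (H : iso (w ∘ P) (P ∘ W)) (H' : iso (w' ∘ P) (P ∘ W'))
  (fM : M ⟶ M') (fw : w ⟶ w') (fW : W ⟶ W') :
  N' ∙ (fM ▷ t1) = (t1 ◁ fw) ∙ N -> H' ∙ (fw ▷ P) = (P ◁ fW) ∙ H ->
  contract N' H' ∙ (c ◁ ((a ◁ (fM ▷ b)) ▷ t)) = fW ∙ contract N H.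
Proof.
move=> /insert_tau_nat eN /slide_P_nat eH; rewrite /contract.
(* Generalizing these isomorphisms keeps simplification from unfolding them. *)
move: (insert_tau N) (insert_tau N') (slide_P H) (slide_P H') eN eH.
move=> i i' j j' eN eH.
rewrite /= [LHS]cmpA -[RHS]cmpA -absorb_nat [RHS]cmpA -!(hcompMr c).
congr (_ ∙ (c ◁ _)).
rewrite -[RHS]cmpA -absorb_nat !cmpA asc_nat; congr (_ ∙ _).
rewrite -[LHS]cmpA -[RHS]cmpA -!(hcompMr a); congr ((a ◁ _) ∙ _).
rewrite !cmpA eN -[RHS]cmpA -absorb_nat !cmpA; congr (_ ∙ _).
by rewrite -[LHS]cmpA -[RHS]cmpA -!(hcompMr t1) eH.
Qed.

End Contraction.

Section ContractionSquares.
Variables (k : fieldType) (B : bicat k) (x y z x' y' z' : B).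
Variables (X : B x x') (Y : B y y') (Z : B z z').
Variables (c : B z x) (t : B x z) (a : B y z) (b : B z y).
Variables (c1 : B y z) (t1 : B z y) (M : B y y) (w : B z z) (W : B x x).
Variables (c' : B z' x') (t' : B x' z') (a' : B y' z') (b' : B z' y').
Variables (c1' : B y' z') (t1' : B z' y').
Variables (M' : B y' y') (w' : B z' z') (W' : B x' x').
Variables (cS : c' ∘ Z ⟶ X ∘ c) (tS : t' ∘ X ⟶ Z ∘ t).
Variables (aS : a' ∘ Y ⟶ Z ∘ a) (bS : b' ∘ Z ⟶ Y ∘ b).
Variables (c1S : c1' ∘ Y ⟶ Z ∘ c1) (t1S : t1' ∘ Z ⟶ Y ∘ t1).
Variables (MS : M' ∘ Y ⟶ Y ∘ M) (wS : w' ∘ Z ⟶ Z ∘ w) (WS : W' ∘ X ⟶ X ∘ W).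
Variables (om : iso (t1 ∘ c1) (id1 y)) (om' : iso (t1' ∘ c1') (id1 y')).
Variables (ab : iso (a ∘ b) (id1 z)) (ab' : iso (a' ∘ b') (id1 z')).
Variables (th : iso (c ∘ t) (id1 x)) (th' : iso (c' ∘ t') (id1 x')).
Variables (N : iso (M ∘ t1) (t1 ∘ w)) (N' : iso (M' ∘ t1') (t1' ∘ w')).
Variables (H : iso (w ∘ (c1 ∘ (b ∘ t))) ((c1 ∘ (b ∘ t)) ∘ W)).
Variables (H' : iso (w' ∘ (c1' ∘ (b' ∘ t'))) ((c1' ∘ (b' ∘ t')) ∘ W')).
Hypothesis om_vmor : vmor (vc t1S c1S) (usq Y) om om'.
Hypothesis ab_vmor : vmor (vc aS bS) (usq Z) ab ab'.
Hypothesis th_vmor : vmor (vc cS tS) (usq X) th th'.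
Hypothesis N_vmor : vmor (vc MS t1S) (vc t1S wS) N N'.
Let PS := vc c1S (vc bS tS).
Hypothesis H_vmor : vmor (vc wS PS) (vc PS WS) H H'.

Lemma contract_vmor :
  vmor (vc cS (vc (vc aS (vc MS bS)) tS)) WS
    (contract om ab th N H) (contract om' ab' th' N' H').
Proof.
apply: vmor_cmp (absorb_vmor th_vmor _) _.
apply: vc_vmor (vmor_id _) _.
apply: vmor_cmp (absorb_vmor ab_vmor _) _.
apply: vmor_cmp (vc_asc _ _ _).
apply: vc_vmor (vmor_id _) _.
apply: vmor_cmp (absorb_vmor om_vmor _) _.
have insert_vmor : vmor (vc (vc MS bS) tS) (vc t1S (vc wS PS))
    (insert_tau t b om N) (insert_tau t' b' om' N').
  apply: vmor_cmp (vc_asc _ _ _) _.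
  apply: vmor_cmp (vc_vmor N_vmor (vmor_id _)) _.
  apply: vmor_cmp (vmor_inv (vc_asc _ _ _)) _.
  apply: vmor_cmp (vc_asc _ _ _).
  apply: vc_vmor (vmor_id _) _; exact: vmor_inv (absorb_vmor om_vmor _).
apply: vmor_cmp insert_vmor.
apply: vc_vmor (vmor_id _) _.
apply: vmor_cmp (vc_vmor (vmor_id _) (vc_asc _ _ _)) _.
apply: vmor_cmp (vc_asc _ _ _) H_vmor.
Qed.

End ContractionSquares.

(** Naturality of the half-braiding at the 2-cell [p], with [hs_comp] expanding it at the composites
    [pC ∘ X0] and [X1 ∘ pA]. *)
Lemma hs_slide (k : fieldType) (B : bicat k) (W : halfbraid B)
  (hW : is_halfbraid W) (A0 C0 A1 C1 : B) (X0 : B A0 C0) (X1 : B A1 C1)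
  (pA : B A0 A1) (pC : B C0 C1) (p : pC ∘ X0 ⟶ X1 ∘ pA) :
  vmor (vc (hs W X1) p) (vc p (hs W X0)) (hs W pA) (hs W pC).
Proof.
rewrite /vmor /sqmor /vc.
have E : (X1 ◁ hs W pA) ∙ asc X1 (W A1) pA ∙ (hs W X1 ▷ pA)
    ∙ (asc (W C1) X1 pA)⁻¹ = asc X1 pA (W A0) ∙ hs W (X1 ∘ pA).
  by rewrite hs_comp // compVKl.
rewrite -[LHS]cmpA -[LHS]cmpA -[LHS]cmpA [X in X ∙ _]cmpA [X in X ∙ _]cmpA E.
rewrite !cmpA (re2 _ (hs_nat hW p)) !cmpA hs_comp // !cmpA bwdK cmpm1.
by [].
Qed.

(** Again naturality at [p] combined with the composition axiom. In the proof [T] is the component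
    at [S ∘ R] with the [pfa] cells stripped off both ends. *)
Lemma pt_slide (k : fieldType) (B Bt : bicat k) (P Q : pseudofun B Bt)
  (t : pntrans P Q) (A0 C0 A1 C1 : B) (X0 : B A0 C0) (X1 : B A1 C1)
  (pA : B A0 A1) (pC : B C0 C1) (p : pC ∘ X0 ⟶ X1 ∘ pA) :
  vmor (vc (Fsq Q p) (pt1 t X0)⁻¹) (vc (pt1 t X1)⁻¹ (Fsq P p))
    (pt1 t pA) (pt1 t pC).
Proof.
pose T (U V E : B) (S : B V E) (R : B U V) :=
  asc (t E) P⟨S⟩ P⟨R⟩ ∙ (pt1 t S ▷ P⟨R⟩) ∙ (asc Q⟨S⟩ (t V) P⟨R⟩)⁻¹
    ∙ (Q⟨S⟩ ◁ pt1 t R) ∙ asc Q⟨S⟩ Q⟨R⟩ (t U).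
have TE (U V E : B) (S : B V E) (R : B U V) :
    (t E ◁ pfa P S R) ∙ T U V E S R = pt1 t (S ∘ R) ∙ (pfa Q S R ▷ t U).
  by rewrite pt_comp.
have E : T _ _ _ X1 pA ∙ (Fsq Q p ▷ t A0) = (t C1 ◁ Fsq P p) ∙ T _ _ _ pC X0.
  apply: (iso_injl (i := hcomp_iso (id_iso (t C1)) (pfa P X1 pA))) => /=.
  rewrite (re2 _ (TE _ _ _ _ _)) !cmpA -hcompMl /Fsq compVKl hcompMl.
  rewrite (re2 _ (pt_nat _ _)) !cmpA -TE -!cmpA -!hcompMr !cmpA compVKl.
  by rewrite hcompMr.
apply: (iso_injl (i := comp_iso (asc (t C1) P⟨X1⟩ P⟨pA⟩)
  (comp_iso (hcomp_iso (pt1 t X1) (id_iso P⟨pA⟩))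
            (inv_iso (asc Q⟨X1⟩ (t A1) P⟨pA⟩))))) => /=.
rewrite /vmor /sqmor /vc.
rewrite !cmpA compKl (re2_id _ (whisklK _ (fwdK _))) compVKl.
transitivity ((T _ _ _ X1 pA ∙ (Fsq Q p ▷ t A0))
    ∙ (asc Q⟨pC⟩ Q⟨X0⟩ (t A0))⁻¹ ∙ (Q⟨pC⟩ ◁ (pt1 t X0)⁻¹)
    ∙ asc Q⟨pC⟩ (t C0) P⟨X0⟩); first by rewrite /T !cmpA.
rewrite E /T !cmpA compVKl (re2_id _ (whiskrK _ (fwdK _))) bwdK cmpm1.
by [].
Qed.

Lemma conj_transport (k : fieldType) (B : bicat k) (a c : B) (chi : B a c)
  (tau : B c a) (p p' q q' : B a a) (W W' : B c c) (b : iso p q)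
  (b' : iso p' q') (g : p ⟶ p') (h : q ⟶ q') (f : W ⟶ W')
  (i : iso (conj1 chi tau p) W) (i' : iso (conj1 chi tau p') W') :
  b' ∙ g = h ∙ b -> i' ∙ (chi ◁ (g ▷ tau)) = f ∙ i ->
  (i' ∙ (chi ◁ (b'⁻¹ ▷ tau))) ∙ (chi ◁ (h ▷ tau)) =
  f ∙ i ∙ (chi ◁ (b⁻¹ ▷ tau)).
Proof.
move=> eb ei; rewrite -[RHS]cmpA -ei [LHS]cmpA [RHS]cmpA; congr (_ ∙ _).
rewrite -!hcompMr -!hcompMl; congr (_ ◁ (_ ▷ _)).
apply: (iso_injl (i := b')); apply: (iso_injr (i := b)).
by rewrite compVKl !cmpA bwdK cmpm1 eb.
Qed.

(** * The two induced functors are quasi-inverse *)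

Section QuasiInverse.
Variables (k : fieldType) (B Bt : bicat k).
Variables (F : pseudofun B Bt) (G : pseudofun Bt B).
Variables (q1 : quasi_inverse F G) (q2 : quasi_inverse G F).
Variables (chi1 : pntrans (comp_pf F G) (id_pf Bt)).
Variables (tau1 : pntrans (id_pf Bt) (comp_pf F G)).
Variables (ct1 : mutually_inverse chi1 tau1).
Variables (om1 : modification (comp_pt tau1 chi1) (id_pt (comp_pf F G))).
Variables (om1I : is_invertible om1).
Variables (chi2 : pntrans (comp_pf G F) (id_pf B)).
Variables (tau2 : pntrans (id_pf B) (comp_pf G F)).
Variables (ct2 : mutually_inverse chi2 tau2).
Variables (om2 : modification (comp_pt tau2 chi2) (id_pt (comp_pf G F))).
Variables (om2I : is_invertible om2).

Let D1 := BiequivData q1 ct1 om1I.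
Let D2 := BiequivData q2 ct2 om2I.

(* [D1] and [D2] are spelled out so that [bG D1 = G] and [bG D2 = F] hold by
   computation. *)
Lemma Fhat_quasi_inverse h10 h11 h20 h21 :
  natiso (comp_functor (@Fhat k B Bt F D1 h10 h11) (@Fhat k Bt B G D2 h20 h21))
    (id_functor (center Bt)).
Proof.
have [_ [m1 m1I]] := ct1; have [_ [m2 m2I]] := ct2.
pose om C := sval (is_iso_exists (om1I C)).
have omE C : fwd (om C) = om1 C by rewrite /om; case: is_iso_exists.
pose th C := sval (is_iso_exists (m1I C)).
have thE C : fwd (th C) = m1 C by rewrite /th; case: is_iso_exists.
pose th2 C := sval (is_iso_exists (m2I C)).
have th2E C : fwd (th2 C) = m2 C by rewrite /th2; case: is_iso_exists.
pose ab g : iso (F⟨chi2 g⟩ ∘ F⟨tau2 g⟩) (id1 (F g)) :=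
  comp_iso (inv_iso (pfu F g))
    (comp_iso (fmap_iso F (th2 g)) (pfa F (chi2 g) (tau2 g))).
have omV (A C : Bt) (X : Bt A C) :
    vmor (vc (pt1 tau1 X)⁻¹ (pt1 chi1 X)⁻¹) (usq F⟨G⟨X⟩⟩) (om A) (om C).
  by rewrite !omE; have := mdV_nat om1 X; rewrite comp_ptV.
have thV (A C : Bt) (X : Bt A C) :
    vmor (vc (pt1 chi1 X)⁻¹ (pt1 tau1 X)⁻¹) (usq X) (th A) (th C).
  by rewrite !thE; have := mdV_nat m1 X; rewrite comp_ptV.
have th2V (A C : B) (X : B A C) :
    vmor (vc (pt1 chi2 X)⁻¹ (pt1 tau2 X)⁻¹) (usq X) (th2 A) (th2 C).
  by rewrite !th2E; have := mdV_nat m2 X; rewrite comp_ptV.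
have abV (A C : B) (X : B A C) :
    vmor (vc (Fsq F (pt1 chi2 X)⁻¹) (Fsq F (pt1 tau2 X)⁻¹)) (usq F⟨X⟩)
      (ab A) (ab C).
  apply: vmor_cmp (vmor_inv (Fsq_usq F X)) _.
  by apply: vmor_cmp (Fsq_vmor F (th2V _ _ X)) (Fsq_vc _ _ _).
pose P C := chi1 (F (G C)) ∘ (F⟨tau2 (G C)⟩ ∘ tau1 C).
pose H (W : center_ob Bt) C := sval (is_iso_exists (hs_iso (zlaw W) (P C))).
have HE W C : fwd (H W C) = hs W (P C) by rewrite /H; case: is_iso_exists.
(* [F] is distributed over the three factors of [Fhat_ob D2 W] at [G C], to reach the form that
   [contract] takes. *)
pose be (W : center_ob Bt) C := comp_iso
  (pfa F (chi2 (G C)) (G⟨W (F (G C))⟩ ∘ tau2 (G C)))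
  (hcomp_iso (id_iso F⟨chi2 (G C)⟩) (pfa F G⟨W (F (G C))⟩ (tau2 (G C)))).
pose ka (W : center_ob Bt) C := contract (om (F (G C))) (ab (G C)) (th C)
  (pt1 tau1 (W (F (G C)))) (H W C).
pose ep (W : center_ob Bt) C : iso (Fhat_ob D1 (Fhat_ob D2 W) C) (W C) :=
  comp_iso (ka W C)
    (inv_iso (hcomp_iso (id_iso (chi1 C))
                (hcomp_iso (be W C) (id_iso (tau1 C))))).
have epP (W : center_ob Bt) :
    @is_center_hom k Bt (Fhat_ob D1 (Fhat_ob D2 W)) W (ep W).
  move=> A C X; apply/vmorP.
  have -> : hs (Fhat_ob D1 (Fhat_ob D2 W)) X =
    vc (pt1 chi1 X)⁻¹ (vc (Fsq F (vc (pt1 chi2 G⟨X⟩)⁻¹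
      (vc (Fsq G (hs W F⟨G⟨X⟩⟩)) (pt1 tau2 G⟨X⟩)⁻¹))) (pt1 tau1 X)⁻¹).
    rewrite [LHS]Fhat_hsE; congr (vc _ (vc (Fsq F _) _)); exact: Fhat_hsE.
  have beV : vmor (vc (Fsq F (pt1 chi2 G⟨X⟩)⁻¹)
      (vc (Fsq F (Fsq G (hs W F⟨G⟨X⟩⟩))) (Fsq F (pt1 tau2 G⟨X⟩)⁻¹)))
      (Fsq F (vc (pt1 chi2 G⟨X⟩)⁻¹
      (vc (Fsq G (hs W F⟨G⟨X⟩⟩)) (pt1 tau2 G⟨X⟩)⁻¹))) (be W A) (be W C).
    apply: vmor_cmp (Fsq_vc _ _ _) _.
    exact: vc_vmor (vmor_id _) (Fsq_vc _ _ _).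
  apply: vmor_cmp; last first.
    apply: vmor_inv; apply: vc_vmor (vmor_id _) _.
    exact: vc_vmor beV (vmor_id _).
  apply: (contract_vmor (wS := hs W F⟨G⟨X⟩⟩)) (omV _ _ _) (abV _ _ _) (thV _ _ _) _ _.
    (* The square for [N]: [tau1] slides past the half-braiding of [W]. The images of that square
       under the identity and the composite pseudofunctor are first simplified. *)
    have := pt_slide tau1 (hs W F⟨G⟨X⟩⟩).
    have -> : Fsq (id_pf Bt) (hs W F⟨G⟨X⟩⟩) = hs W F⟨G⟨X⟩⟩.
      by rewrite /Fsq /= cmp1m cmpm1.
    have -> : Fsq (comp_pf F G) (hs W F⟨G⟨X⟩⟩) = Fsq F (Fsq G (hs W F⟨G⟨X⟩⟩)).
      by rewrite /Fsq /= !pfM !cmpA.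
    by move=> e; exact: e.
  rewrite !HE; exact: hs_slide (zlaw W) _ _ _ _ _ _ _ _ _.
exists (fun W => center_iso (V := CenterOb (h10 (CenterOb (h20 W)))) (epP W)).
move=> V W f; apply: center_hom_eq => C.
pose fz := f (F (G C)).
have beN : be W C ∙ (F⟨chi2 (G C)⟩ ◁ (F⟪G⟪fz⟫⟫ ▷ F⟨tau2 (G C)⟩)) =
    F⟪chi2 (G C) ◁ (G⟪fz⟫ ▷ tau2 (G C))⟫ ∙ be V C.
  rewrite /= !cmpA -hcompMr pfa_natr hcompMr (re2 _ (pfa_natl _ _ _)) !cmpA.
  by [].
have kaN : ka W C ∙ (chi1 C ◁ ((F⟨chi2 (G C)⟩
    ◁ (F⟪G⟪fz⟫⟫ ▷ F⟨tau2 (G C)⟩)) ▷ tau1 C)) = f C ∙ ka V C.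
  apply: contract_nat (pt_nat tau1 fz) _.
  by rewrite !HE; apply: esym (zmapP f (P C)).
exact: conj_transport beN kaN.
Qed.

End QuasiInverse.

Theorem proposition4p11 (k : closedFieldType) (B Bt : bicat k)
    (hB : is_finite_2cat B) (hBt : is_finite_2cat Bt)
    (F : pseudofun B Bt) (hF : is_biequivalence F) :
  inhabited (biequiv_data F) /\
  forall D : biequiv_data F,
  exists (h0 : forall V : center_ob B, is_halfbraid (Fhat_ob D V))
         (h1 : forall (V W : center_ob B) (f : center_hom V W),
            is_center_hom (Fhat_map D f))
         (h2 : forall V W : center_ob B, is_center_hom (Fhat_J D V W)),
    is_monoidal_equivalence (F := Fhat h0 h1)
      (fun V W : center B => CenterHom (h2 V W)).
Proof.
split.
  have [G q] := hF; have [_ [chi [tau ct]]] := q; have [[om omI] _] := ct.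
  exact: inhabits (BiequivData q ct omI).
case=> G q chi tau ct om omI; pose D := BiequivData q ct omI.
(* The other half of the quasi-inverse property yields the same data with [F] and [G] exchanged. *)
have [[chi2 [tau2 ct2]] qr] := q; have [[om2 om2I] _] := ct2.
have q2 : quasi_inverse G F by split=> //; exists chi2, tau2.
pose D2 := BiequivData q2 ct2 om2I.
exists (fun V => FhatP D (zlaw V)), (fun V W f => Fhat_mapP D f).
exists (fun V W => Fhat_JP D V W).
split; first exact: Fhat_monoidal.
split; first exact: Fhat_linfun.
exists (LinFun (Fhat_linfun (D := D2) (fun V => FhatP D2 (zlaw V))
  (fun V W f => Fhat_mapP D2 f))).
(* The first composite is the case with [D] and [D2] exchanged. *)
by split; apply: Fhat_quasi_inverse.
Qed.
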